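(* Let $1\le p\le n$. There is an EREW PRAM algorithm that performs parallel packing on an array of length $n$ in $O(n)$ work and $O\!\left(\frac{n}{p}\log p\right)$ span given $O(p)$ processors, each having $O(1)$ words of private memory. The algorithm is in-place: it allocates no shared memory aside from the input array.
   Context: PRAM model: synchronous processors with a shared memory, each processor also having its own private memory, measured in words. In the EREW (Exclusive-Read, Exclusive-Write) PRAM, no two processors may read or write the same shared memory location concurrently. Work is the total number of operations performed; span is the maximum number of operations performed by a single processor (here, when the algorithm runs on the stated number of processors). In the bounds, $\log p$ is read as $\max\{1,\log p\}$. Packing problem: given an array of length $n$ in shared memory containing $0$'s and $1$'s in any order (the entries may be elements labelled $0$ or $1$), rearrange the array so that all the $1$'s appear at the beginning of the array, followed by all the $0$'s. *)

(* Defs.v *)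
From mathcomp Require Import all_boot all_order all_algebra.

Set Implicit Arguments.
Unset Strict Implicit.
Unset Printing Implicit Defensive.

Inductive arith := Add | Sub | Mul | Div | Mod.

(* All processors run the same program, a finite list of instructions over k
   private registers of one word each; jump targets are absolute positions, and
   a processor has halted once its program counter is outside the list. *)
Inductive instr (k : nat) :=
| Const of 'I_k & nat              (* d := c *)
| GetId of 'I_k                    (* d := index of this processor *)
| GetLen of 'I_k                   (* d := length of the array *)
| GetPar of 'I_k                   (* d := the parameter p *)
| Arith of arith & 'I_k & 'I_k & 'I_k  (* d := a op b *)
| Label of 'I_k & 'I_k             (* d := label (0 or 1) of the element in a *)
| Read of 'I_k & 'I_k              (* d := shared[a] *)
| Write of 'I_k & 'I_k             (* shared[a] := s *)
| Jump of nat
| JumpLt of 'I_k & 'I_k & nat      (* jump if a < b *)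
| Wait of 'I_k.                    (* stay idle for the next a steps *)

Definition program (k : nat) := seq (instr k).

(* What a run depends on, apart from the program, the number of processors and
   the contents of the array. *)
Record setting := Setting {
  wbits : nat;          (* words are the naturals below 2 ^ wbits *)
  label : nat -> bool;  (* label of an array entry *)
  len : nat;
  par : nat
}.

Record proc (k : nat) := Proc {
  pc : nat;
  delay : nat;          (* remaining idle steps *)
  reg : 'I_k -> nat
}.

(* The shared memory consists of the len E cells of the array and nothing else. *)
Record config (E : setting) (k P : nat) := Config {
  shared : (len E).-tuple nat;
  procs : 'I_P -> proc k
}.

(* Sub is truncated; division by 0 gives quotient 0 and remainder the dividend.
   Overflow wraps around, since every write to a register is reduced below. *)
Definition arith_eval (o : arith) : nat -> nat -> nat :=
  match o with
  | Add => addn | Sub => subn | Mul => muln | Div => divn | Mod => modn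
  end.

Definition exec (E : setting) (k : nat) (id : nat) (mem : seq nat)
    (i : instr k) (s : proc k) : proc k :=
  let r := reg s in
  let put d v :=
    Proc (pc s).+1 0 (fun x => if x == d then v %% 2 ^ wbits E else r x) in
  match i with
  | Const d c => put d c
  | GetId d => put d id
  | GetLen d => put d (len E)
  | GetPar d => put d (par E)
  | Arith o d a b => put d (arith_eval o (r a) (r b))
  | Label d a => put d (label E (r a))
  | Read d a => put d (nth 0 mem (r a))
  | Write _ _ => Proc (pc s).+1 0 r
  | Jump t => Proc t 0 r
  | JumpLt a b t => Proc (if r a < r b then t else (pc s).+1) 0 r
  | Wait a => Proc (pc s).+1 (r a) r
  end.

(* The operation a processor performs in the current step: none if it has
   halted or is idle. *)
Definition current (k : nat) (prog : program k) (s : proc k) : option (instr k) :=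
  if delay s == 0 then onth prog (pc s) else None.

Definition halted (k : nat) (prog : program k) (s : proc k) : bool :=
  size prog <= pc s.

Definition access (k : nat) (prog : program k) (s : proc k) : option nat :=
  match current prog s with
  | Some (Read _ a) | Some (Write a _) => Some (reg s a)
  | _ => None
  end.

Definition written (k : nat) (prog : program k) (s : proc k) : option (nat * nat) :=
  match current prog s with
  | Some (Write a v) => Some (reg s a, reg s v)
  | _ => None
  end.

Definition proc_step (E : setting) (k : nat) (prog : program k) (id : nat)
    (mem : seq nat) (s : proc k) : proc k :=
  match current prog s with
  | Some i => exec E id mem i s
  | None => Proc (pc s) (delay s).-1 (reg s)
  end.

(* The value left in cell a; under erew (below), at most one processor writes
   to it. *)
Definition cell_step (E : setting) (k P : nat) (prog : program k)
    (c : config E k P) (a : 'I_(len E)) : nat :=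
  match [pick i | omap fst (written prog (procs c i)) == Some (val a)] with
  | Some i => odflt 0 (omap snd (written prog (procs c i)))
  | None => tnth (shared c) a
  end.

(* Reads see the memory as it was at the beginning of the step. *)
Definition step (E : setting) (k P : nat) (prog : program k)
    (c : config E k P) : config E k P :=
  Config [tuple cell_step prog c a | a < len E]
         (fun i => proc_step E prog i (shared c) (procs c i)).

Definition start (E : setting) (k P : nat) (A : (len E).-tuple nat) : config E k P :=
  Config A (fun _ => Proc 0 0 (fun _ => 0)).

Definition run (E : setting) (k P : nat) (prog : program k)
    (A : (len E).-tuple nat) (t : nat) : config E k P :=
  iter t (step prog) (start k P A).

Definition erew (E : setting) (k P : nat) (prog : program k)
    (c : config E k P) : Prop :=
  forall (i j : 'I_P) (a : nat), access prog (procs c i) = Some a ->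
    access prog (procs c j) = Some a -> i = j.

Definition in_bounds (E : setting) (k P : nat) (prog : program k)
    (c : config E k P) : Prop :=
  forall (i : 'I_P) (a : nat), access prog (procs c i) = Some a -> a < len E.

(* Idle steps are not operations (the Wait itself is one), so pram_span alone
   does not bound the running time. *)
Definition ops (E : setting) (k P : nat) (prog : program k)
    (A : (len E).-tuple nat) (T : nat) (i : 'I_P) : nat :=
  \sum_(t < T) isSome (current prog (procs (run P prog A t) i)).

Definition pram_work (E : setting) (k P : nat) (prog : program k)
    (A : (len E).-tuple nat) (T : nat) : nat :=
  \sum_(i < P) ops prog A T i.

Definition pram_span (E : setting) (k P : nat) (prog : program k)
    (A : (len E).-tuple nat) (T : nat) : nat :=
  \max_(i < P) ops prog A T i.

Definition packing_of (lab : nat -> bool) (A B : seq nat) : Prop :=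
  perm_eq B A /\
  [seq lab x | x <- B] = nseq (count lab A) true ++ nseq (count (predC lab) A) false.

(* max {1, floor (log_2 m)} *)
Definition lg (m : nat) : nat := maxn 1 (trunc_log 2 m).

Arguments run E [k] P prog A t.
Arguments pram_work E [k] P prog A T.
Arguments pram_span E [k] P prog A T.

(* Main.v *)
Require Import Defs.
From mathcomp Require Import all_boot all_order all_algebra.
From mathcomp Require Import zify.

(* Only about p / log p processors work.  Each packs its own segment of S = n / q
   cells sequentially, which takes time S = O(n / p * log p).  Prefix sums of the
   numbers f i of ones per segment then tell every processor the positions and the
   ranks of its misplaced zeros and ones: the total m is the boundary, zeros left
   of m are ranked from the left and ones right of m from the right, and the zero
   and the one of equal rank have to be exchanged.  In a segment the misplaced
   zeros (ones) have consecutive ranks, so for each s < S at most one of them has a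
   rank r congruent to s modulo S.  There are S rounds; in round s the owner of
   the zero of rank r = t * S + s leaves its address in cell t, from which the
   owner of the one of rank r reads it, and the latter makes the exchange.  The
   only scratch memory needed, by the rounds and by the prefix sums, is cells
   0, ..., q - 1; processor i keeps the element of cell i in a register meanwhile.

   The number of processors: the loop x := x ^ 2, y := 2 * y finds y with
   log p < y <= 2 * log p in log log p iterations, and halving the number of live
   processors in each of them keeps the work O(p).

   The live processors stay in lock-step because the two branches of every
   conditional are padded to the same length. *)

Set Implicit Arguments.
Unset Strict Implicit.
Unset Printing Implicit Defensive.

(** * Runs of the machine *)

Section Machine.
Variables (E : setting) (k P : nat) (prog : program k).
Implicit Types (c : config E k P) (s : proc k).

Definition safe c := erew prog c /\ in_bounds prog c.

Definition step_ops c := \sum_(i < P) isSome (current prog (procs c i)).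

(** The time [t] is exact, while [w] only bounds the operations from above. Safety concerns the
    configurations in which a step starts, hence not [c'], so that runs concatenate. *)
Definition reach c t w c' :=
  [/\ c' = iter t (step prog) c,
      forall j, j < t -> safe (iter j (step prog) c)
    & \sum_(j < t) step_ops (iter j (step prog) c) <= w].

Lemma reach0 c : reach c 0 0 c.
Proof. by split=> //; rewrite big_ord0. Qed.

Lemma reach_cat c1 t1 w1 c2 t2 w2 c3 :
  reach c1 t1 w1 c2 -> reach c2 t2 w2 c3 -> reach c1 (t1 + t2) (w1 + w2) c3.
Proof.
move=> [-> H1 W1] [-> H2 W2]; split.
- by rewrite addnC iterD.
- move=> j Hj; case: (ltnP j t1) => [/H1 //|Hle].
  by rewrite -(subnK Hle) iterD; apply: H2; lia.
rewrite big_split_ord leq_add //=.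
by under eq_bigr => i _ do rewrite addnC iterD.
Qed.

Definition dead s := (size prog <= pc s) && (delay s == 0).

Lemma dead_current s : dead s -> current prog s = None.
Proof.
case/andP=> Hp Hd; rewrite /current Hd.
by elim: (prog) (pc s) Hp => [|a l IH] [|m] //= /IH.
Qed.

Lemma dead_step id mem s : dead s -> dead (proc_step E prog id mem s).
Proof.
move=> Hs; rewrite /proc_step (dead_current Hs).
by case/andP: Hs => Hp /eqP Hd; rewrite /dead Hp /= Hd.
Qed.

Lemma step_ops_le c q :
  (forall i : 'I_P, q <= i -> dead (procs c i)) -> step_ops c <= q.
Proof.
move=> Hd; rewrite /step_ops.
apply: (@leq_trans (\sum_(i < P) (i < q))).
  apply: leq_sum => i _; case: ltnP => [_|Hi]; first by case: isSome.
  by rewrite (dead_current (Hd _ Hi)).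
suff -> : \sum_(i < P) (i < q) = minn P q by exact: geq_minr.
elim: (P) => [|m IH]; first by rewrite big_ord0 min0n.
by rewrite big_ord_recr /= IH; case: ltnP; lia.
Qed.

(** Dead processors stay dead and perform nothing, so each of the [t] steps costs at most [q]
    operations. *)
Lemma reach_ops_le c t c' q :
  (forall i : 'I_P, q <= i -> dead (procs c i)) ->
  c' = iter t (step prog) c ->
  (forall j, j < t -> safe (iter j (step prog) c)) ->
  reach c t (t * q) c' /\ (forall i : 'I_P, q <= i -> dead (procs c' i)).
Proof.
move=> Hd -> Hs.
have Hj j : forall i : 'I_P, q <= i -> dead (procs (iter j (step prog) c) i).
  by elim: j => //= j IH i Hi; apply: dead_step; apply: IH.
split; last exact: Hj.
split=> //.
rewrite -[X in _ <= X * q](card_ord t) -sum_nat_const; apply: leq_sum => j _.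
exact/step_ops_le/Hj.
Qed.

(** One processor alone against a frozen memory: without shared accesses the processors do not
    interact. *)
Definition idle_run id mem t s s' :=
  iter t (proc_step E prog id mem) s = s' /\
  forall j, j < t -> access prog (iter j (proc_step E prog id mem) s) = None.

Lemma idle_run_cat id mem t1 t2 s1 s2 s3 :
  idle_run id mem t1 s1 s2 -> idle_run id mem t2 s2 s3 ->
  idle_run id mem (t1 + t2) s1 s3.
Proof.
move=> [<- H1] [<- H2]; split; first by rewrite addnC iterD.
move=> j Hj; case: (ltnP j t1) => [/H1 //|Hle].
by rewrite -(subnK Hle) iterD; apply: H2; lia.
Qed.

Lemma dead_idle_run id mem t s : dead s -> exists2 s', idle_run id mem t s s' & dead s'.
Proof.
move=> Hs; have Hd j : dead (iter j (proc_step E prog id mem) s).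
  by elim: j => //= j; apply: dead_step.
exists (iter t (proc_step E prog id mem) s) => //; split=> // j _.
by rewrite /access (dead_current (Hd j)).
Qed.

Lemma access_written s : omap fst (written prog s) != None ->
  omap fst (written prog s) = access prog s.
Proof. by rewrite /written /access; case: current => [[]|]. Qed.

Lemma shared_step_keep c (a : nat) : a < len E ->
  (forall i : 'I_P, omap fst (written prog (procs c i)) <> Some a) ->
  nth 0 (shared (step prog c)) a = nth 0 (shared c) a.
Proof.
move=> Ha Hw.
rewrite -[a]/(val (Ordinal Ha)) -!tnth_nth tnth_mktuple /cell_step.
by case: pickP => // i /eqP /Hw.
Qed.

(** Whichever writer [pick] chooses in [cell_step], it accesses cell [a], so exclusiveness
    identifies it with [i]. *)
Lemma shared_step_write c (i : 'I_P) (a v : nat) : safe c ->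
  written prog (procs c i) = Some (a, v) ->
  nth 0 (shared (step prog c)) a = v.
Proof.
move=> [He Hb] Hi.
have Hacc : access prog (procs c i) = Some a.
  by rewrite -access_written Hi.
have Ha := Hb _ _ Hacc.
rewrite -[a]/(val (Ordinal Ha)) -!tnth_nth tnth_mktuple /cell_step /=.
case: pickP => [j /eqP Hj|/(_ i)]; last by rewrite Hi eqxx.
have Hjacc : access prog (procs c j) = Some a by rewrite -access_written Hj.
by rewrite (He _ _ _ Hjacc Hacc) Hi.
Qed.

Lemma quiet_step c : (forall i : 'I_P, access prog (procs c i) = None) ->
  safe c /\ shared (step prog c) = shared c.
Proof.
move=> Hn; split; first by split=> i; [move=> j a|move=> a]; rewrite Hn.
apply: val_inj; apply: (@eq_from_nth _ 0) => [|a]; rewrite !size_tuple // => Ha.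
apply: shared_step_keep => // i Hi.
by have := @access_written (procs c i); rewrite Hi Hn => /(_ isT).
Qed.

(** Without shared accesses the array never changes, so a synchronous run splits into independent
    runs against the initial array, and safety is vacuous. *)
Lemma run_idle c t (post : 'I_P -> proc k -> Prop) :
  (forall i : 'I_P, exists2 s', idle_run i (shared c) t (procs c i) s' & post i s') ->
  let c' := iter t (step prog) c in
  [/\ shared c' = shared c, forall i, post i (procs c' i)
    & forall j, j < t -> safe (iter j (step prog) c)].
Proof.
move=> H c'.
have Hj j : j <= t -> shared (iter j (step prog) c) = shared c /\ forall i : 'I_P,
    procs (iter j (step prog) c) i = iter j (proc_step E prog i (shared c)) (procs c i).
  elim: j => // j IH Hj; have [Hs Hp] := IH (ltnW Hj).
  have Hq i : access prog (procs (iter j (step prog) c) i) = None.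
    by rewrite Hp; have [s' [_ /(_ _ Hj)]] := H i.
  split; first by rewrite iterS (quiet_step Hq).2.
  by move=> i; rewrite /= Hs Hp.
have [Hs Hp] := Hj t (leqnn _); split=> //.
  by move=> i; rewrite Hp; have [s' [-> _]] := H i.
move=> j Hjt; have [_ Hpj] := Hj j (ltnW Hjt).
by apply: (quiet_step _).1 => i; rewrite Hpj; have [s' [_ /(_ _ Hjt)]] := H i.
Qed.

Definition code_at (l : nat) (cs : program k) :=
  forall j, j < size cs -> onth prog (l + j) = onth cs j.

Lemma code_at_cat l u v :
  code_at l (u ++ v) -> code_at l u /\ code_at (l + size u) v.
Proof.
move=> H; split=> j Hj.
  by rewrite H ?size_cat ?ltn_addr // onth_cat Hj.
by rewrite -addnA H ?size_cat ?ltn_add2l // onth_cat ltnNge leq_addr addKn.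
Qed.

Lemma code_at1 l i : code_at l [:: i] -> onth prog l = Some i.
Proof. by move=> /(_ 0 isT); rewrite addn0. Qed.

Definition quiet (i : instr k) :=
  match i with Read _ _ | Write _ _ => false | _ => true end.

Lemma idle_run1 id mem s i : onth prog (pc s) = Some i -> delay s = 0 -> quiet i ->
  idle_run id mem 1 s (exec E id mem i s).
Proof.
move=> Hi Hd Hq; split; first by rewrite /= /proc_step /current Hd Hi.
by case=> // _; rewrite /access /current Hd Hi /=; case: i Hq {Hi}.
Qed.

End Machine.

(** * A structured language for lock-step programs *)

(** Registers below [nvar] hold the program variables, those from [nvar] on are the evaluation stack
    of expressions, and the last one is only the target of [nop]. *)
Local Notation nvar := 32.
Local Notation nreg := 40.
Local Notation R x := (inord x : 'I_nreg).
Local Notation nop := (Const (R nreg.-1) 0).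

Inductive expr := V of nat | C of nat | Id | Len | Par | Op of arith & expr & expr.

Inductive atom :=
| Set_ of nat & expr
| Ld of nat & nat
| St of nat & nat
| Lb of nat & nat.

Inductive cmd :=
| At of atom
| If of nat & nat & seq atom
| Halt of nat & nat
| Seq of cmd & cmd
| While of nat & nat & cmd.

(** [d] is the top of the evaluation stack. The machine has no move instruction, so a variable is
    copied by adding it to zero. *)
Fixpoint ecode (e : expr) (d : nat) : program nreg :=
  match e with
  | V x => [:: Const (R d) 0; Arith Add (R d) (R x) (R d)]
  | C c => [:: Const (R d) c]
  | Id => [:: GetId (R d)]
  | Len => [:: GetLen (R d)]
  | Par => [:: GetPar (R d)]
  | Op o a b => ecode a d ++ ecode b d.+1 ++ [:: Arith o (R d) (R d) (R d.+1)]
  end.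

Fixpoint ewf (e : expr) (d : nat) : bool :=
  match e with
  | V x => (x < nvar) && (d < nreg.-1)
  | Op o a b => ewf a d && ewf b d.+1
  | _ => d < nreg.-1
  end.

Definition acode (a : atom) : program nreg :=
  match a with
  | Set_ x e => ecode e nvar ++
                  [:: Const (R nvar.+1) 0; Arith Add (R x) (R nvar) (R nvar.+1)]
  | Ld x a => [:: Read (R x) (R a)]
  | St a v => [:: Write (R a) (R v)]
  | Lb x a => [:: Label (R x) (R a)]
  end.

Fixpoint esize (e : expr) : nat :=
  match e with
  | V _ => 2
  | Op _ a b => (esize a + esize b).+1
  | _ => 1
  end.

Definition asize (a : atom) : nat := if a is Set_ _ e then (esize e).+2 else 1.

Definition awf (a : atom) : bool :=
  match a with
  | Set_ x e => (x < nvar) && ewf e nvar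
  | Ld x y | St x y | Lb x y => (x < nvar) && (y < nvar)
  end.

Definition bcode (b : seq atom) : program nreg := flatten (map acode b).

Fixpoint bsize (b : seq atom) : nat := if b is a :: b' then asize a + bsize b' else 0.

Lemma size_ecode e d : size (ecode e d) = esize e.
Proof. by elim: e d => //= o a IHa b IHb d; rewrite !size_cat IHa IHb /= addn1 addnS. Qed.

Lemma size_acode a : size (acode a) = asize a.
Proof. by case: a => //= x e; rewrite size_cat size_ecode addn2. Qed.

Lemma size_bcode b : size (bcode b) = bsize b.
Proof. by elim: b => //= a b IH; rewrite size_cat size_acode IH. Qed.

Fixpoint csize (c : cmd) : nat :=
  match c with
  | At a => asize a
  | If _ _ b => (2 * (bsize b).+1).+1
  | Halt _ _ => 1
  | Seq c1 c2 => csize c1 + csize c2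
  | While _ _ c => (csize c).+3
  end.

(* Both branches of an [If] take the same number of steps, so that the
   processors leave it in lock-step. *)
Fixpoint ccode (fin l : nat) (c : cmd) : program nreg :=
  match c with
  | At a => acode a
  | If x y b =>
      let t := bsize b in let stop := l + (2 * t.+1).+1 in
      [:: JumpLt (R x) (R y) (l + t.+2)] ++ (nseq t nop ++ [:: Jump _ stop]) ++
      bcode b ++ [:: Jump _ stop]
  | Halt x y => [:: JumpLt (R x) (R y) fin]
  | Seq c1 c2 => ccode fin l c1 ++ ccode fin (l + csize c1) c2
  | While x y c =>
      [:: JumpLt (R x) (R y) l.+2; Jump _ (l + (csize c).+3)] ++
      ccode fin l.+2 c ++ [:: Jump _ l]
  end.

Fixpoint cwf (c : cmd) : bool :=
  match c with
  | At a => awf a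
  | If x y b => [&& x < nvar, y < nvar & all awf b]
  | Halt x y => (x < nvar) && (y < nvar)
  | Seq c1 c2 => cwf c1 && cwf c2
  | While x y c => [&& x < nvar, y < nvar & cwf c]
  end.

Lemma size_ccode fin l c : size (ccode fin l c) = csize c.
Proof.
elim: c l => //= [a|x y b|c1 IH1 c2 IH2|x y c IH] l.
- exact: size_acode.
- by rewrite !size_cat size_nseq size_bcode /=; lia.
- by rewrite size_cat IH1 IH2.
- by rewrite size_cat IH /= addn1.
Qed.

(* The processors below [alive] run in lock-step on the variables [regs] and the
   array [cells], the others have halted; [clk] and [wrk] count the time and the
   operations spent. *)
Record state := State {
  alive : nat;
  regs : nat -> nat -> nat;
  cells : nat -> nat;
  clk : nat;
  wrk : nat
}.

(** Effect of one synchronous write by the processors below [q] in the mask [m]. [find] returns [q]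
    exactly when none of them addresses [a], and then the cell is kept. *)
Definition store (q : nat) (m : pred nat) (ad vl cells : nat -> nat) : nat -> nat :=
  fun a => let i := find (fun i => m i && (ad i == a)) (iota 0 q) in
           if i < q then vl i else cells a.

Definition inj_on (q : nat) (m : pred nat) (ad : nat -> nat) :=
  forall i j, i < q -> j < q -> m i -> m j -> ad i = ad j -> i = j.

Lemma store_hit q (m : pred nat) ad vl cells i : i < q -> m i -> inj_on q m ad ->
  store q m ad vl cells (ad i) = vl i.
Proof.
move=> Hi Hm Hinj; rewrite /store.
set P := fun _ => _.
have Hh : has P (iota 0 q).
  by apply/hasP; exists i; rewrite ?mem_iota // /P Hm eqxx.
have := nth_find 0 Hh; move: Hh; rewrite has_find size_iota => Hf.
rewrite nth_iota // add0n Hf => /andP[Hm' /eqP Heq].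
by congr vl; apply: Hinj.
Qed.

Lemma store_miss q (m : pred nat) ad vl cells a :
  (forall i, i < q -> m i -> ad i <> a) -> store q m ad vl cells a = cells a.
Proof.
move=> H; rewrite /store; case: ifP => // Hf.
have : has (fun i => m i && (ad i == a)) (iota 0 q) by rewrite has_find size_iota.
case/hasP=> i; rewrite mem_iota add0n /= => Hi /andP[Hm /eqP Ha].
by case: (H i Hi Hm Ha).
Qed.

(** * Predicate-transformer semantics of commands *)

Section Semantics.
Variable E : setting.
Let B := 2 ^ wbits E.

Fixpoint ev (id : nat) (r : nat -> nat) (e : expr) : nat :=
  match e with
  | V x => r x | C c => c | Id => id | Len => len E | Par => par E
  | Op o a b => arith_eval o (ev id r a) (ev id r b)
  end.

(** Bounding every intermediate value excludes wrap-around, so that [ev] over the naturals agrees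
    with machine arithmetic. *)
Fixpoint fits (id : nat) (r : nat -> nat) (e : expr) : Prop :=
  match e with
  | Op o a b => [/\ fits id r a, fits id r b & ev id r e < B]
  | _ => ev id r e < B
  end.

Definition put (m : pred nat) (x : nat) (f : nat -> nat) (r : nat -> nat -> nat) :=
  fun i y => if y == x then if m i then f i else r i y else r i y.

Definition exec_atom (m : pred nat) (a : atom) (s : state) : state :=
  let: State q r M t w := s in
  match a with
  | Set_ x e => State q (put m x (fun i => ev i (r i) e) r) M t w
  | Ld x a => State q (put m x (fun i => M (r i a)) r) M t w
  | Lb x a => State q (put m x (fun i => label E (r i a)) r) M t w
  | St a v => State q r (store q m (fun i => r i a) (fun i => r i v) M) t w
  end.

Definition ok_atom (m : pred nat) (a : atom) (s : state) : Prop :=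
  let: State q r M t w := s in
  match a with
  | Set_ x e => forall i, i < q -> m i -> fits i (r i) e
  | Ld x a => (forall i, i < q -> m i -> r i a < len E /\ M (r i a) < B) /\
              inj_on q m (fun i => r i a)
  | Lb x a => True
  | St a v => (forall i, i < q -> m i -> r i a < len E) /\ inj_on q m (fun i => r i a)
  end.

Definition spend (t : nat) (s : state) : state :=
  let: State q r M t0 w0 := s in State q r M (t0 + t) (w0 + t * q).

Fixpoint ok_block (m : pred nat) (b : seq atom) (s : state) : Prop :=
  if b is a :: b' then ok_atom m a s /\ ok_block m b' (exec_atom m a s) else True.

Fixpoint exec_block (m : pred nat) (b : seq atom) (s : state) : state :=
  if b is a :: b' then exec_block m b' (exec_atom m a s) else s.

Definition uniform (b : bool) (x y : nat) (s : state) : Prop :=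
  forall i, i < alive s -> (regs s i x < regs s i y) = b.

(** A loop is not padded like a conditional, so all live processors have to agree on its test. An
    iteration pays one step for the test and one for the jump back; the exit pays two, the failed
    test and the jump out. *)
Fixpoint wloop (x y : nat) (body : (state -> Prop) -> state -> Prop) (N : nat)
    (Q : state -> Prop) (s : state) : Prop :=
  if N is N'.+1 then
    uniform true x y s /\ body (fun s' => wloop x y body N' Q (spend 1 s')) (spend 1 s)
  else uniform false x y s /\ Q (spend 2 s).

(** The survivors of a [Halt] must form an initial segment of the indices, so that the single number
    [alive] still describes them. An [If] costs the test, one padded branch and the closing jump,
    whichever branch is taken. *)
Fixpoint wp (c : cmd) (Q : state -> Prop) (s : state) : Prop :=
  match c with
  | At a => ok_atom xpredT a s /\ Q (spend (asize a) (exec_atom xpredT a s))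
  | If x y b =>
      let m := fun i => regs s i x < regs s i y in
      ok_block m b s /\ Q (spend (bsize b).+2 (exec_block m b s))
  | Halt x y => exists q, [/\ q <= alive s,
        forall i, i < alive s -> (regs s i x < regs s i y) = (q <= i)
      & Q (State q (regs s) (cells s) (clk s).+1 (wrk s + alive s))]
  | Seq c1 c2 => wp c1 (wp c2 Q) s
  | While x y c => exists N, wloop x y (wp c) N Q s
  end.

(** * Simulation of commands by their machine code *)

Variables (P : nat) (prog : program nreg).
Hypothesis B_gt1 : 1 < B.
Implicit Types (cf : config E nreg P).

Notation steps := (idle_run E prog).
Notation code_at := (code_at prog).

Lemma R_eq x y : x < nreg -> y < nreg -> (R x == R y) = (x == y).
Proof. by move=> Hx Hy; rewrite -val_eqE /= !inordK. Qed.

Lemma B_gt0 : 0 < B. Proof. exact: ltnW. Qed.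

Definition runs id mem (t : nat) (s : proc nreg) (post : proc nreg -> Prop) :=
  exists2 s', steps id mem t s s' & [/\ pc s' = pc s + t, delay s' = 0 & post s'].

Lemma ewf_lt e d : ewf e d -> d < nreg.-1.
Proof. by elim: e d => //= [x d /andP[]|o a IHa b IHb d /andP[/IHa]]. Qed.

Lemma ecode_quiet e d : all (@quiet _) (ecode e d).
Proof. by elim: e d => //= o a IHa b IHb d; rewrite !all_cat IHa IHb. Qed.

Lemma put_run i d v id mem s : onth prog (pc s) = Some i -> delay s = 0 -> quiet i ->
  exec E id mem i s = Proc (pc s).+1 0 (fun x => if x == R d then v %% B else reg s x) ->
  v < B -> d < nreg -> runs id mem 1 s (fun s' =>
    reg s' (R d) = v /\ forall x, x < d -> reg s' (R x) = reg s (R x)).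
Proof.
move=> Hi Hdel Hq He Hv Hd; exists (exec E id mem i s); first exact: idle_run1.
rewrite He; split=> //=; first by rewrite addn1.
by split=> [|x Hx]; [rewrite eqxx modn_small | rewrite R_eq ?ltn_eqF //; lia].
Qed.

(** Registers below [d] survive the evaluation; this protects the variables, and also the left
    operand of an operation, which waits while the right one is computed above it. *)
Lemma ecode_run e d id mem s r : ewf e d -> nvar <= d -> delay s = 0 ->
  code_at (pc s) (ecode e d) -> (forall x, x < nvar -> reg s (R x) = r x) ->
  fits id r e ->
  runs id mem (size (ecode e d)) s (fun s' =>
    reg s' (R d) = ev id r e /\ forall x, x < d -> reg s' (R x) = reg s (R x)).
Proof.
elim: e d s => [x|c||||o a IHa b IHb] d s Hwf Hd Hdel Hc Hr Hf; last first.
  case/andP: Hwf => wa wb; case: Hf => fa fb fe.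
  case/code_at_cat: Hc => ca /code_at_cat[cb /code_at1 co].
  have [s1 r1 [p1 d1 [v1 k1]]] := IHa d s wa Hd Hdel ca Hr fa.
  have Hr1 x : x < nvar -> reg s1 (R x) = r x.
    by move=> Hx; rewrite k1 ?Hr //; apply: leq_trans Hd.
  rewrite -p1 in cb.
  have [s2 r2 [p2 d2 [v2 k2]]] := IHb d.+1 s1 wb (leqW Hd) d1 cb Hr1 fb.
  rewrite -p1 -p2 in co.
  have Hdn := ewf_lt wb.
  exists (exec E id mem (Arith o (R d) (R d) (R d.+1)) s2).
    rewrite [ecode _ _]/= !size_cat; apply: idle_run_cat r1 _; apply: idle_run_cat r2 _.
    exact: idle_run1.
  rewrite /= !size_cat /=; split=> //; first by rewrite p2 p1; lia.
  split; first by rewrite eqxx (k2 d) // v1 v2 modn_small.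
  move=> x Hx; rewrite R_eq ?ltn_eqF ?k2 ?k1 //; lia.
all: have Hdn := ewf_lt Hwf.
1-4: by apply: put_run (code_at1 Hc) _ _ _ _ _ => //; apply: ltnW.
have [c1 c2] := code_at_cat (u := [:: _]) (v := [:: _]) Hc.
move/code_at1: c1 => c1; move/code_at1: c2; rewrite addn1 => c2.
set s1 := exec E id mem (Const (R d) 0) s.
exists (exec E id mem (Arith Add (R d) (R x) (R d)) s1).
  by apply: (@idle_run_cat _ _ _ _ _ 1 1 _ s1); apply: idle_run1.
split=> //=; first by rewrite addn2.
case/andP: Hwf => Hx _; split.
  rewrite !eqxx mod0n addn0 R_eq ?ltn_eqF ?Hr ?modn_small //; lia.
by move=> y Hy; rewrite R_eq ?ltn_eqF //; lia.
Qed.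

Lemma nops_run t id mem s : delay s = 0 -> code_at (pc s) (nseq t nop) ->
  runs id mem t s (fun s' => forall x, x < nvar -> reg s' (R x) = reg s (R x)).
Proof.
elim: t s => [|t IH] s Hd Hc.
  by exists s; rewrite ?addn0 //; split=> // j.
have [/code_at1 c1 c2] := code_at_cat (u := [:: _]) Hc.
set s1 := exec E id mem nop s.
have [|s2 r2 [p2 d2 k2]] := IH s1 erefl; first by move: c2; rewrite addn1.
exists s2.
  by apply: (@idle_run_cat _ _ _ _ _ 1 t _ s1) => //; apply: idle_run1.
split=> //; first by rewrite p2 /= addnS.
by move=> x Hx; rewrite k2 //= R_eq ?ltn_eqF //; lia.
Qed.

(** [pcs] gives each processor its own position because, inside a conditional, lock-step processors
    stand in different branches. *)
Definition matches cf (s : state) (pcs : nat -> nat) :=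
  [/\ alive s <= P,
      forall i : 'I_P, i < alive s ->
        [/\ pc (procs cf i) = pcs i, delay (procs cf i) = 0
          & forall x, x < nvar -> reg (procs cf i) (R x) = regs s i x],
      forall i : 'I_P, alive s <= i -> dead prog (procs cf i)
    & forall a, a < len E -> nth 0 (shared cf) a = cells s a].

Lemma matches_idle cf s pcs t s' (pcs' : nat -> nat) : matches cf s pcs ->
  alive s' = alive s -> cells s' = cells s ->
  (forall i : 'I_P, i < alive s ->
    exists2 p', steps i (shared cf) t (procs cf i) p' &
      [/\ pc p' = pcs' i, delay p' = 0
        & forall x, x < nvar -> reg p' (R x) = regs s' i x]) ->
  exists2 cf', reach prog cf t (t * alive s) cf' & matches cf' s' pcs'.
Proof.
case=> HP Hm Hd Hc Ha Hcells H.
have [i|] := @run_idle E nreg P prog cf t (fun i p' =>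
    (i < alive s -> [/\ pc p' = pcs' i, delay p' = 0
        & forall x, x < nvar -> reg p' (R x) = regs s' i x])).
  case: (ltnP i (alive s)) => Hi; first by have [p' ? ?] := H i Hi; exists p'.
  by have [p' ? _] := dead_idle_run E i (shared cf) t (Hd i Hi); exists p'.
move=> Hsh Hpost Hsafe.
have [Hr Hd'] := reach_ops_le Hd erefl Hsafe.
exists (iter t (step prog) cf) => //.
by split; rewrite ?Ha // => a Ha'; rewrite Hsh Hcells Hc.
Qed.

Definition branch (m : pred nat) (pcs : nat -> nat) (cs : program nreg) s :=
  forall i, i < alive s ->
    code_at (pcs i) (if m i then cs else nseq (size cs) nop).

Lemma alive_exec m a s : alive (exec_atom m a s) = alive s.
Proof. by case: s => *; case: a. Qed.

Lemma atom_sim_idle m a cf s pcs : matches cf s pcs -> all (@quiet _) (acode a) ->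
  awf a -> ok_atom m a s -> branch m pcs (acode a) s ->
  exists2 cf', reach prog cf (size (acode a)) (size (acode a) * alive s) cf'
             & matches cf' (exec_atom m a s) (fun i => pcs i + size (acode a)).
Proof.
move=> Hcf Hq Hwf Hok Hbr.
apply: (matches_idle Hcf); [exact: alive_exec | by case: (s); case: (a) Hq | ].
case: Hcf => _ Hm _ _ i Hi; have [Hpc Hdel Hreg] := Hm i Hi.
have := Hbr i Hi; case: ifP => Hmi; rewrite -Hpc => Hcode; last first.
  have [p' Hp' [H1 H2 H3]] := nops_run i (shared cf) Hdel Hcode.
  exists p' => //; split=> // x Hx; rewrite H3 // Hreg //.
  by case: (s) => *; case: (a) Hq => //= *; rewrite /put Hmi; case: eqP.
case: s Hok Hi Hreg {Hm Hbr} => q r M t w Hok /= Hi Hreg.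
case: a Hwf Hok Hcode Hq => //= x; last first.
  move=> y /andP[Hx Hy] _ /code_at1 Hc _.
  exists (exec E i (shared cf) (Label (R x) (R y)) (procs cf i)).
    exact: idle_run1.
  split=> //=; first by rewrite addn1.
  move=> z Hz; rewrite R_eq ?(ltn_trans Hz, ltn_trans Hx) // Hreg // /put Hmi.
  by case: eqP => _; rewrite ?Hreg // modn_small //; case: label => //; apply: B_gt0.
move=> e /andP[Hx We] Hok /code_at_cat[c1 c2] _.
have [p1 r1 [pc1 d1 [v1 k1]]] := ecode_run (shared cf) We (leqnn _) Hdel c1 Hreg (Hok i Hi Hmi).
have [/code_at1 c3 /code_at1 c4] := code_at_cat (u := [:: _]) (v := [:: _]) c2.
set p2 := exec E i (shared cf) (Const (R nvar.+1) 0) p1.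
exists (exec E i (shared cf) (Arith Add (R x) (R nvar) (R nvar.+1)) p2).
  rewrite size_cat; apply: idle_run_cat r1 _.
  apply: (@idle_run_cat _ _ _ _ _ 1 1 _ p2); apply: idle_run1 => //=.
    by rewrite pc1.
  by rewrite pc1; move: c4; rewrite addn1.
rewrite size_cat /=; split=> //; first by rewrite pc1; lia.
move=> z Hz; rewrite /put Hmi !R_eq ?(ltn_trans Hz, ltn_trans Hx) //.
have -> : (z == nvar.+1) = false by apply/ltn_eqF/ltnW.
have -> : (nvar == nvar.+1) = false by [].
rewrite eqxx mod0n addn0 v1.
case: eqP => _; last by rewrite k1 // Hreg.
rewrite modn_small //.
by have := Hok i Hi Hmi; case: (e) => //= ? ? ? [].
Qed.
Lemma branch_current m pcs ins cf s (i : 'I_P) : matches cf s pcs ->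
  branch m pcs [:: ins] s -> i < alive s ->
  current prog (procs cf i) = Some (if m i then ins else nop).
Proof.
move=> [_ Hm _ _] Hbr Hi; have [Hpc Hdel _] := Hm i Hi.
rewrite /current Hdel Hpc; have := Hbr i Hi.
by case: ifP => _ /code_at1.
Qed.

Lemma access_safe m pcs ins x cf s : matches cf s pcs ->
  branch m pcs [:: ins] s ->
  (exists y, ins = Read y (R x) \/ ins = Write (R x) y) -> x < nvar ->
  (forall i, i < alive s -> m i -> regs s i x < len E) ->
  inj_on (alive s) m (fun i => regs s i x) ->
  safe prog cf.
Proof.
move=> Hcf Hbr Hins Hx Hlt Hinj.
have Hacc (i : 'I_P) a : access prog (procs cf i) = Some a ->
    [/\ i < alive s, m i & a = regs s i x].
  case: (ltnP i (alive s)) => Hi; last first.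
    by case: Hcf => _ _ Hd _; rewrite /access (dead_current (Hd i Hi)).
  rewrite /access (branch_current Hcf Hbr Hi); case: ifP => // Hmi.
  case: Hcf => _ /(_ i Hi)[_ _ Hr] _ _.
  by case: Hins => y [->|->] [<-]; rewrite Hr.
split=> [i j a /Hacc[Hi Hmi ->] /Hacc[Hj Hmj Heq]|i a /Hacc[Hi Hmi ->]].
  by apply: val_inj; apply: Hinj.
exact: Hlt.
Qed.

Lemma read_sim m x y cf s pcs : matches cf s pcs -> awf (Ld x y) ->
  ok_atom m (Ld x y) s -> branch m pcs (acode (Ld x y)) s ->
  exists2 cf', reach prog cf 1 (1 * alive s) cf'
             & matches cf' (exec_atom m (Ld x y) s) (fun i => pcs i + 1).
Proof.
move=> Hcf /andP[Hx Hy] Hok Hbr; set ins := Read (R x) (R y).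
have Hsafe : safe prog cf.
  case: s Hcf Hok Hbr => q r M t w Hcf [Hok Hinj] Hbr.
  apply: (access_safe Hcf Hbr) Hy _ Hinj; first by exists (R x); left.
  by move=> i Hi Hmi; have [] := Hok i Hi Hmi.
have Hcur i := @branch_current m pcs ins cf s i Hcf Hbr.
case: (Hcf) => HP Hm Hd Hc.
(* With a single step only [j = 0] matters; for a successor, [j'.+1 < 1] computes to [false]. *)
have [Hr Hd'] := reach_ops_le (t := 1) Hd erefl (fun j => match j with 0 => fun _ => Hsafe | j'.+1 => fun H => False_ind _ (Bool.diff_false_true H) end).
exists (step prog cf) => //.
case: s Hcf Hok Hcur Hc Hm Hd {Hbr Hr} Hd' HP => q r M t w Hcf [Hok Hinj] /= Hcur Hc Hm Hd Hd' HP.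
split=> //= [i Hi|a Ha]; last first.
  rewrite -Hc // -[LHS]/(nth 0 (shared (step prog cf)) a); apply: shared_step_keep => // i.
  case: (ltnP i q) => Hi; last by rewrite /written (dead_current (Hd i Hi)).
  by rewrite /written Hcur //; case: ifP.
have [Hpc Hdel Hreg] := Hm i Hi.
rewrite /proc_step Hcur //; case: ifP => Hmi /=; split=> //; rewrite ?Hpc ?addn1 //.
  move=> z Hz; rewrite /put Hmi R_eq ?(ltn_trans Hz, ltn_trans Hx) // !Hreg //.
  by have [H1 H2] := Hok i Hi Hmi; case: eqP => // _; rewrite Hc // modn_small.
move=> z Hz; have Hz' : z < nreg.-1 by exact: leq_trans Hz _.
by rewrite /put Hmi if_same R_eq ?(ltn_trans Hz') // ltn_eqF // Hreg.
Qed.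

Lemma write_sim m x y cf s pcs : matches cf s pcs -> awf (St x y) ->
  ok_atom m (St x y) s -> branch m pcs (acode (St x y)) s ->
  exists2 cf', reach prog cf 1 (1 * alive s) cf'
             & matches cf' (exec_atom m (St x y) s) (fun i => pcs i + 1).
Proof.
move=> Hcf /andP[Hx Hy] Hok Hbr; set ins := Write (R x) (R y).
have Hsafe : safe prog cf.
  case: s Hcf Hok Hbr => q r M t w Hcf [Hok Hinj] Hbr.
  by apply: (access_safe Hcf Hbr) Hx _ Hinj => //; exists (R y); right.
have Hcur i := @branch_current m pcs ins cf s i Hcf Hbr.
case: (Hcf) => HP Hm Hd Hc.
have [Hr Hd'] := reach_ops_le (t := 1) Hd erefl (fun j => match j with 0 => fun _ => Hsafe | j'.+1 => fun H => False_ind _ (Bool.diff_false_true H) end).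
exists (step prog cf) => //.
case: s Hcf Hok Hcur Hc Hm Hd {Hbr Hr} Hd' HP => q r M t w Hcf [Hok Hinj] /= Hcur Hc Hm Hd Hd' HP.
split=> //= [i Hi|a Ha].
  have [Hpc Hdel Hreg] := Hm i Hi.
  rewrite /proc_step Hcur //; case: ifP => Hmi /=; split=> //; rewrite ?Hpc ?addn1 //.
  by move=> z Hz; rewrite R_eq ?ltn_eqF ?Hreg //; lia.
rewrite -[LHS]/(nth 0 (shared (step prog cf)) a).
have Hw (i : 'I_P) : written prog (procs cf i) =
    if (i < q) && m i then Some (r i x, r i y) else None.
  case: ltnP => Hi; last by rewrite /written (dead_current (Hd i Hi)).
  have [_ _ Hreg] := Hm i Hi.
  by rewrite /written Hcur //; case: ifP => //= _; rewrite !Hreg.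
case: (pickP (fun i : 'I_P => [&& i < q, m i & r i x == a])) => [i /and3P[Hi Hmi /eqP <-]|Hn].
  rewrite (store_hit _ _ Hi Hmi Hinj); apply: (shared_step_write (i := i) Hsafe).
  by rewrite Hw Hi Hmi.
rewrite store_miss ?(shared_step_keep Ha) ?Hc // => i.
  rewrite Hw; case: andP => //= -[Hi Hmi] [Ha'].
  by have := Hn i; rewrite Hi Hmi Ha' eqxx.
move=> Hi Hmi Ha'; have := Hn (Ordinal (leq_trans Hi HP)).
by rewrite /= Hi Hmi Ha' eqxx.
Qed.

Lemma atom_sim m a cf s pcs : matches cf s pcs ->
  awf a -> ok_atom m a s -> branch m pcs (acode a) s ->
  exists2 cf', reach prog cf (size (acode a)) (size (acode a) * alive s) cf'
             & matches cf' (exec_atom m a s) (fun i => pcs i + size (acode a)).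
Proof.
case: a => [x e|x y|x y|x y] Hcf Hwf.
- by apply: atom_sim_idle; rewrite //= all_cat ecode_quiet.
- exact: read_sim.
- exact: write_sim.
- exact: atom_sim_idle.
Qed.

Lemma block_sim m b cf s pcs : matches cf s pcs ->
  all awf b -> ok_block m b s -> branch m pcs (bcode b) s ->
  exists2 cf', reach prog cf (size (bcode b)) (size (bcode b) * alive s) cf'
             & matches cf' (exec_block m b s) (fun i => pcs i + size (bcode b)).
Proof.
elim: b cf s pcs => [|a b IH] cf s pcs Hcf.
  exists cf; first exact: reach0.
  by case: Hcf => ? Hm ? ?; split=> // i /Hm[]; split; rewrite ?addn0.
case/andP=> Wa Wb [Oa Ob] Hbr.
have Hbr' i : i < alive s ->
    code_at (pcs i) (if m i then acode a else nseq (size (acode a)) nop) /\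
    code_at (pcs i + size (acode a)) (if m i then bcode b else nseq (size (bcode b)) nop).
  move=> /Hbr; rewrite [bcode _]/= size_cat nseqD; case: ifP => _ /code_at_cat //.
  by rewrite size_nseq.
have [|cf1 r1 m1] := atom_sim Hcf Wa Oa; first by move=> i /Hbr'[].
have [|cf2 r2 m2] := IH _ _ _ m1 Wb Ob.
  by move=> i; rewrite alive_exec => /Hbr'[].
exists cf2; rewrite [bcode _]/= size_cat.
  by rewrite mulnDl -{2}(alive_exec m a); apply: reach_cat r1 r2.
by case: m2 => ? Hm ? ?; split=> // i /Hm[]; split; rewrite ?addnA.
Qed.

Lemma alive_block m b s : alive (exec_block m b s) = alive s.
Proof. by elim: b s => //= a b IH s; rewrite IH alive_exec. Qed.

Lemma jump_sim cf s pcs (stop : nat) : matches cf s pcs ->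
  (forall i, i < alive s -> onth prog (pcs i) = Some (Jump _ stop)) ->
  exists2 cf', reach prog cf 1 (alive s) cf' & matches cf' s (fun=> stop).
Proof.
move=> Hcf Hj; rewrite -[alive s]mul1n.
apply: (matches_idle Hcf) => // i Hi; case: Hcf => _ /(_ i Hi)[Hpc Hdel Hreg] _ _.
exists (exec E i (shared cf) (Jump _ stop) (procs cf i)) => //.
by apply: idle_run1 => //; rewrite Hpc Hj.
Qed.

Lemma jumplt_sim cf s l (x y stop : nat) : matches cf s (fun=> l) ->
  x < nvar -> y < nvar -> onth prog l = Some (JumpLt (R x) (R y) stop) ->
  exists2 cf', reach prog cf 1 (alive s) cf'
    & matches cf' s (fun i => if regs s i x < regs s i y then stop else l.+1).
Proof.
move=> Hcf Hx Hy Hj; rewrite -[alive s]mul1n.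
apply: (matches_idle Hcf) => // i Hi; case: Hcf => _ /(_ i Hi)[Hpc Hdel Hreg] _ _.
exists (exec E i (shared cf) (JumpLt (R x) (R y) stop) (procs cf i)) => //.
  by apply: idle_run1 => //; rewrite Hpc Hj.
by split=> //=; rewrite Hpc !Hreg.
Qed.

Lemma matches_spend cf s pcs t : matches cf s pcs -> matches cf (spend t s) pcs.
Proof. by case: s. Qed.

Lemma matches_pc cf s (pcs pcs' : nat -> nat) : matches cf s pcs ->
  (forall i, i < alive s -> pcs i = pcs' i) -> matches cf s pcs'.
Proof. by case=> ? Hm ? ? He; split=> // i Hi; have [] := Hm i Hi; rewrite He. Qed.

(** [clk] is exact while [wrk] bounds from above; [wrk s <= wrk s'] keeps the truncated difference
    meaningful when pieces are chained. *)
Definition simulated (Q : state -> Prop) cf s stop :=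
  exists t cf' s', [/\ reach prog cf t (wrk s' - wrk s) cf',
    wrk s <= wrk s', clk s' = clk s + t, matches cf' s' (fun=> stop) & Q s'].

Lemma simulated_trans (Q : state -> Prop) cf s cf1 s1 t w stop :
  reach prog cf t w cf1 -> wrk s1 = wrk s + w -> clk s1 = clk s + t ->
  simulated Q cf1 s1 stop -> simulated Q cf s stop.
Proof.
move=> r1 Hw Ht [t2 [cf2 [s2 [r2 H1 H2 H3 H4]]]].
exists (t + t2), cf2, s2; split=> //; last by rewrite H2 Ht addnA.
  by have := reach_cat r1 r2; congr (reach _ _ _ _ _); lia.
by apply: leq_trans H1; rewrite Hw leq_addr.
Qed.

Lemma simulated0 (Q : state -> Prop) cf s stop :
  matches cf s (fun=> stop) -> Q s -> simulated Q cf s stop.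
Proof.
by move=> Hm HQ; exists 0, cf, s; split=> //; rewrite ?addn0 // subnn; apply: reach0.
Qed.

Lemma clk_exec m a s : (clk (exec_atom m a s) = clk s) * (wrk (exec_atom m a s) = wrk s).
Proof. by case: s => *; case: a. Qed.

Lemma clk_block m b s :
  (clk (exec_block m b s) = clk s) * (wrk (exec_block m b s) = wrk s).
Proof. by elim: b s => //= a b IH s; rewrite !IH !clk_exec. Qed.

Lemma clk_spend t s : ((clk (spend t s) = clk s + t) *
  (wrk (spend t s) = wrk s + t * alive s)) * (alive (spend t s) = alive s).
Proof. by case: s. Qed.

Lemma simulated_wp fin c (Q : state -> Prop) cf s l : size prog <= fin -> cwf c ->
  code_at l (ccode fin l c) -> matches cf s (fun=> l) -> wp c Q s ->
  simulated Q cf s (l + csize c).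
Proof.
move=> Hfin.
elim: c l Q cf s => [a|x y b|x y|c1 IH1 c2 IH2|x y c IH] l Q cf s Hwf Hcode Hcf.
- case=> Hok HQ.
  have [|cf1 r1 m1] := atom_sim Hcf Hwf Hok; first by move=> i _.
  rewrite size_acode in r1 m1.
  apply: simulated_trans r1 _ _ (simulated0 (matches_spend _ m1) HQ).
    by rewrite clk_spend clk_exec alive_exec.
  by rewrite clk_spend clk_exec.
- case/and3P: Hwf => Hx Hy Hb [Hok HQ].
  set m := fun i => regs s i x < regs s i y in Hok HQ *.
  set t := bsize b in HQ; have size_b : size (bcode b) = t by exact: size_bcode.
  case/code_at_cat: Hcode => /code_at1 Hj /code_at_cat[/code_at_cat[Hnop Hj1]].
  case/code_at_cat; rewrite /= !size_cat !size_nseq /= size_b => Hthen Hj2.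
  rewrite size_nseq /= addn1 in Hj1; move/code_at1: Hj1 => Hj1; move/code_at1: Hj2 => Hj2.
  have [cf1 r1 m1] := jumplt_sim Hcf Hx Hy Hj.
  (* The real branch and the [nop] branch have the same length, so one masked block simulation moves
     all processors at once. *)
  have [|cf2 r2 m2] := block_sim m1 Hb Hok.
    move=> i Hi; rewrite -/(m i) size_b; case: (m i).
      by move: Hthen; congr code_at; lia.
    by move: Hnop; rewrite addn1.
  rewrite size_b in r2 m2.
  have [|cf3 r3 m3] := jump_sim (stop := l + (2 * t.+1).+1) m2.
    move=> i _ /=; rewrite -/(m i); case: (m i).
      by rewrite -Hj2; congr onth; lia.
    by rewrite -Hj1; congr onth; lia.
  have r4 := reach_cat r1 (reach_cat r2 r3).
  apply: simulated_trans r4 _ _ (simulated0 (matches_spend t.+2 m3) HQ).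
    by rewrite clk_spend clk_block alive_block -/t !mulSn; lia.
  by rewrite clk_spend clk_block -/t; lia.
- case/andP: Hwf => Hx Hy [q [Hq Hh HQ]].
  have [cf1 r1 m1] := jumplt_sim Hcf Hx Hy (code_at1 Hcode).
  apply: simulated_trans r1 _ _ (simulated0 _ HQ) => //=; first by rewrite addn1.
  case: m1 => HP Hm Hd Hc; split=> //=.
  + exact: leq_trans HP.
  + move=> i Hi; have Hi' := leq_trans Hi Hq; have [-> -> Hr] := Hm i Hi'.
    by split=> //; rewrite Hh // leqNgt Hi addn1.
  (* A halting processor jumps to [fin], which lies beyond the program, and is dead from then on. *)
  + move=> i Hi; case: (ltnP i (alive s)) => Hi'; last exact: Hd.
    by have [Hpc Hdel _] := Hm i Hi'; rewrite /dead Hpc Hdel Hh // Hi Hfin.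
- case/andP: Hwf => W1 W2 H.
  case/code_at_cat: Hcode; rewrite size_ccode => C1 C2.
  have [t1 [cf1 [s1 [r1 w1 k1 m1 q1]]]] := IH1 _ _ _ _ W1 C1 Hcf H.
  rewrite /= addnA; apply: simulated_trans r1 _ k1 (IH2 _ _ _ _ W2 C2 m1 q1).
  by rewrite subnKC.
case/and3P: Hwf => Hx Hy Wc [N HN].
case/(code_at_cat (u := [:: _; _])): Hcode => HJ.
case/code_at_cat; rewrite size_ccode /= addn2 => Cc /code_at1 Hback.
have /code_at1 Hj := (code_at_cat (u := [:: _]) HJ).1.
have /code_at1 := (code_at_cat (u := [:: _]) HJ).2; rewrite addn1 => Hexit.
(* The body is covered by the induction on commands; the iterations need this second induction on
   their number. *)
elim: N cf s Hcf HN => [|N IHN] cf s Hcf [Hu HN];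
    have [cf1 r1 m1] := jumplt_sim Hcf Hx Hy Hj.
  have [|cf2 r2 m2] := jump_sim (stop := l + (csize c).+3) m1.
    by move=> i Hi; rewrite Hu.
  apply: simulated_trans (reach_cat r1 r2) _ _ (simulated0 (matches_spend 2 m2) HN).
    by rewrite clk_spend; lia.
  by rewrite clk_spend.
have m1' : matches cf1 (spend 1 s) (fun=> l.+2).
  by apply/matches_spend/(matches_pc m1) => i Hi; rewrite Hu.
apply: (simulated_trans (s1 := spend 1 s) r1); rewrite ?clk_spend ?mul1n //.
have [t2 [cf2 [s2 [r2 w2 k2 m2 q2]]]] := IH _ _ _ _ Wc Cc m1' HN.
apply: simulated_trans r2 _ k2 _; first by rewrite subnKC.
have [|cf3 r3 m3] := jump_sim (stop := l) m2; first by move=> i _; rewrite -Hback.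
apply: simulated_trans r3 _ _ (IHN _ _ (matches_spend 1 m3) q2).
  by rewrite clk_spend mul1n.
by rewrite clk_spend.
Qed.
End Semantics.

(** * Weakest preconditions and the program *)

Section Rules.
Variable E : setting.
Let B := 2 ^ wbits E.

Lemma wloop_mono x y (body : (state -> Prop) -> state -> Prop) N (Q Q' : state -> Prop) s :
  (forall (P P' : state -> Prop) s, (forall s', P s' -> P' s') -> body P s -> body P' s) ->
  (forall s', Q s' -> Q' s') -> wloop x y body N Q s -> wloop x y body N Q' s.
Proof.
move=> Hb HQ; elim: N s => [|N IH] s [Hu H]; split=> //; first exact: HQ.
by apply: Hb H => s' /IH.
Qed.

Lemma wp_mono c (Q Q' : state -> Prop) s :
  (forall s', Q s' -> Q' s') -> wp E c Q s -> wp E c Q' s.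
Proof.
elim: c Q Q' s => [a|x y b|x y|c1 IH1 c2 IH2|x y c IH] Q Q' s HQ.
- by move=> [Ho /HQ].
- by move=> [Ho /HQ].
- by move=> [q [Hq Hh /HQ H]]; exists q.
- by apply: IH1 => s'; apply: IH2.
by move=> [N H]; exists N; apply: wloop_mono H.
Qed.

Lemma wp_seq c1 c2 (Q : state -> Prop) s : wp E c1 (wp E c2 Q) s -> wp E (Seq c1 c2) Q s.
Proof. by []. Qed.

Lemma wp_set x e (Q : state -> Prop) q r M t w :
  (forall i, i < q -> fits E i (r i) e) ->
  Q (State q (put xpredT x (fun i => ev E i (r i) e) r) M
       (t + asize (Set_ x e)) (w + asize (Set_ x e) * q)) ->
  wp E (At (Set_ x e)) Q (State q r M t w).
Proof. by move=> Hf HQ; split=> // i Hi _; apply: Hf. Qed.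

Lemma wp_load x a (Q : state -> Prop) q r M t w :
  (forall i, i < q -> r i a < len E /\ M (r i a) < B) ->
  inj_on q xpredT (fun i => r i a) ->
  Q (State q (put xpredT x (fun i => M (r i a)) r) M (t + 1) (w + 1 * q)) ->
  wp E (At (Ld x a)) Q (State q r M t w).
Proof. by move=> Hf Hi HQ; split=> //; split=> // i Hq _; apply: Hf. Qed.

Lemma wp_store a v (Q : state -> Prop) q r M t w :
  (forall i, i < q -> r i a < len E) ->
  inj_on q xpredT (fun i => r i a) ->
  Q (State q r (store q xpredT (fun i => r i a) (fun i => r i v) M) (t + 1) (w + 1 * q)) ->
  wp E (At (St a v)) Q (State q r M t w).
Proof. by move=> Hf Hi HQ; split=> //; split=> // i Hq _; apply: Hf. Qed.

Definition wpb (m : pred nat) (b : seq atom) (Q : state -> Prop) (s : state) :=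
  ok_block E m b s /\ Q (exec_block E m b s).

Lemma wpb_nil m (Q : state -> Prop) s : Q s -> wpb m [::] Q s.
Proof. by []. Qed.

Lemma wpb_set (m : pred nat) b x e (Q : state -> Prop) q r M t w :
  (forall i, i < q -> m i -> fits E i (r i) e) ->
  wpb m b Q (State q (put m x (fun i => ev E i (r i) e) r) M t w) ->
  wpb m (Set_ x e :: b) Q (State q r M t w).
Proof. by move=> Hf [Ho HQ]; split=> //; split. Qed.

Lemma wpb_load (m : pred nat) b x a (Q : state -> Prop) q r M t w :
  (forall i, i < q -> m i -> r i a < len E /\ M (r i a) < B) ->
  inj_on q m (fun i => r i a) ->
  wpb m b Q (State q (put m x (fun i => M (r i a)) r) M t w) ->
  wpb m (Ld x a :: b) Q (State q r M t w).
Proof. by move=> Hf Hi [Ho HQ]; split=> //; split. Qed.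

Lemma wpb_label (m : pred nat) b x a (Q : state -> Prop) q r M t w :
  wpb m b Q (State q (put m x (fun i => label E (r i a)) r) M t w) ->
  wpb m (Lb x a :: b) Q (State q r M t w).
Proof. by move=> [Ho HQ]; split=> //; split. Qed.

Lemma wpb_store (m : pred nat) b a v (Q : state -> Prop) q r M t w :
  (forall i, i < q -> m i -> r i a < len E) ->
  inj_on q m (fun i => r i a) ->
  wpb m b Q (State q r (store q m (fun i => r i a) (fun i => r i v) M) t w) ->
  wpb m (St a v :: b) Q (State q r M t w).
Proof. by move=> Hf Hi [Ho HQ]; split=> //; split. Qed.

Lemma wp_if x y b (Q : state -> Prop) q r M t w :
  wpb (fun i => r i x < r i y) b (fun s => Q (spend (bsize b).+2 s)) (State q r M t w) ->
  wp E (If x y b) Q (State q r M t w).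
Proof. by []. Qed.

Lemma wp_while x y c (Inv : nat -> state -> Prop) N (Q : state -> Prop) s :
  Inv 0 s ->
  (forall j s, j < N -> Inv j s ->
     uniform true x y s /\ wp E c (fun s' => Inv j.+1 (spend 1 s')) (spend 1 s)) ->
  (forall s, Inv N s -> uniform false x y s /\ Q (spend 2 s)) ->
  wp E (While x y c) Q s.
Proof.
move=> H0 Hstep Hend; exists N.
(* Induction on the number [k] of iterations left, with [N - k] already done. *)
have {H0}: Inv (N - N) s by rewrite subnn.
elim: {-2 3}N (leqnn N) s => [|k IH] Hk s; first by rewrite subn0; apply: Hend.
move=> HI; have [|Hu Hw] := Hstep (N - k.+1) s _ HI; first by lia.
split=> //; apply: wp_mono Hw => s'; rewrite -subSn // subSS; apply: IH.
exact: ltnW.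
Qed.
End Rules.

Arguments put m x f r i y /.
Arguments wp : simpl never.
Arguments wpb : simpl never.

(** * Variables and text of the packing program *)

Local Notation rme := 0 (only parsing).
Local Notation rn := 1 (only parsing).
Local Notation rp := 2 (only parsing).
Local Notation rpp := 3 (only parsing).
Local Notation rx := 4 (only parsing).
Local Notation ry := 5 (only parsing).
Local Notation rt := 6 (only parsing).
Local Notation rq := 7 (only parsing).
Local Notation rS := 8 (only parsing).
Local Notation rlo := 9 (only parsing).
Local Notation rhi := 10 (only parsing).
Local Notation ra := 11 (only parsing).
Local Notation rj := 12 (only parsing).
Local Notation rl := 13 (only parsing).
Local Notation ru := 14 (only parsing).
Local Notation rv := 15 (only parsing).
Local Notation rf := 16 (only parsing).
Local Notation rst := 17 (only parsing).
Local Notation rd := 18 (only parsing).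
Local Notation rme1 := 19 (only parsing).
Local Notation rm := 20 (only parsing).
Local Notation rrho := 21 (only parsing).
Local Notation rsg := 22 (only parsing).
Local Notation rs := 23 (only parsing).
Local Notation rg := 24 (only parsing).
Local Notation rz := 25 (only parsing).
Local Notation ro := 26 (only parsing).
Local Notation rh := 27 (only parsing).
Local Notation rxx := 28 (only parsing).
Local Notation ryy := 29 (only parsing).
Local Notation rw := 30 (only parsing).
Local Notation rzero := 31 (only parsing).

Declare Scope prog_scope.
Delimit Scope prog_scope with P.
Bind Scope prog_scope with expr.
Bind Scope prog_scope with cmd.
Local Notation "! x" := (V x) (at level 0, x at level 0, format "! x") : prog_scope.
Local Notation "# c" := (C c) (at level 0, c at level 0, format "# c") : prog_scope.
Local Notation "a + b" := (Op Add a b) : prog_scope.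
Local Notation "a - b" := (Op Defs.Sub a b) : prog_scope.
Local Notation "a * b" := (Op Mul a b) : prog_scope.
Local Notation "a / b" := (Op Div a b) (at level 40, left associativity) : prog_scope.
Local Notation "a %% b" := (Op Mod a b) : prog_scope.
Local Notation "x ::= e" := (At (Set_ x e%P)) (at level 60) : prog_scope.
Local Notation "c1 ;; c2" := (Seq c1 c2) (at level 65, right associativity) : prog_scope.

(** The loop keeps [rx] equal to 2 to the power [ry]. The test [p < me * y + 1] lets processor [me]
    go on iff [me * y < p], which leaves the ceiling of [p / y] processors. *)
Definition squaring : cmd := (
  rx ::= !rx * !rx ;;
  ry ::= !ry + !ry ;;
  rt ::= !rme * !ry + #1 ;;
  Halt rp rt)%P.

(** [rpp] is [p + 1] because tests are strict: the loop runs while [x <= p]. *)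
Definition prelude : cmd := (
  rme ::= Id ;; rn ::= Len ;; rp ::= Par ;;
  rpp ::= Par + #1 ;; rx ::= #2 ;; ry ::= #1 ;; rzero ::= #0 ;;
  While rx rpp squaring ;;
  rq ::= (!rp + !ry - #1) / !ry ;;
  rS ::= (!rn + !rq - #1) / !rq ;;
  rlo ::= !rme * !rS ;;
  rhi ::= !rlo + !rS ;;
  ra ::= !rlo ;;
  rj ::= !rlo)%P.

(** Partition by a single scan: [ra] is the end of the ones found so far, [rj] the cell inspected,
    and a one at [rj] is exchanged with the element at [ra]. Resetting [rl] makes positions past the
    array behave like zeros. *)
Definition pack_step : cmd := (
  rl ::= #0 ;;
  If rj rn [:: Ld ru rj; Lb rl ru; Ld rv ra] ;;
  If rzero rl [:: St ra ru; St rj rv] ;;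
  ra ::= !ra + !rl ;;
  rj ::= !rj + #1)%P.

Definition local_pack : cmd := While rj rhi pack_step.

(** Doubling in both directions at once, with cell [i] as the mailbox of processor [i]: [rv] sums a
    window ending at [i], [ru] one starting at [i]. *)
Definition scan_step : cmd := (
  At (St rme rv) ;;
  rt ::= !rme - !rd ;;
  If rd rme1 [:: Ld rw rt; Set_ rv (!rv + !rw)%P] ;;
  At (St rme ru) ;;
  rt ::= !rme + !rd ;;
  If rt rq [:: Ld rw rt; Set_ ru (!ru + !rw)%P] ;;
  rd ::= !rd + !rd)%P.

(** Inclusive prefix plus inclusive suffix minus the own count is the total, so every processor
    learns [rm] without a broadcast. [rrho] is the number of zeros before the segment, [rsg] that of
    ones behind it. *)
Definition scan : cmd := (
  rf ::= !ra - !rlo ;;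
  At (Ld rst rme) ;;
  rd ::= #1 ;; rv ::= !rf ;; ru ::= !rf ;; rme1 ::= !rme + #1 ;;
  While rd rq scan_step ;;
  At (St rme rst) ;;
  rm ::= !rv + !ru - !rf ;;
  rrho ::= !rlo - (!rv - !rf) ;;
  rsg ::= !rm - !rv ;;
  rs ::= #0)%P.

(** [rg] encodes a conjunction: a product of truncated differences is positive iff both are. Adding
    [S] minus a remainder replaces subtraction modulo [S]. The second [rg] uses [ro] before its
    decrement, where [m < ro] says that position [ro - 1] is at least [m]. *)
Definition round : cmd := (
  At (Ld rst rme) ;;
  rt ::= (!rs + (!rS - !rrho %% !rS)) %% !rS ;;
  rz ::= !ra + !rt ;;
  rg ::= (!rhi - !rz) * (!rm - !rz) ;;
  rt ::= (!rrho + !rt) / !rS ;;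
  If rzero rg [:: St rt rz] ;;
  rt ::= (!rs + (!rS - !rsg %% !rS)) %% !rS ;;
  ro ::= !ra - !rt ;;
  rg ::= (!rf - !rt) * (!ro - !rm) ;;
  ro ::= !ro - #1 ;;
  rt ::= (!rsg + !rt) / !rS ;;
  If rzero rg [:: Ld rh rt] ;;
  At (St rme rst) ;;
  If rzero rg [:: Ld rxx ro; Ld ryy rh; St ro ryy; St rh rxx] ;;
  rs ::= !rs + #1)%P.

Definition packing : cmd := (
  prelude ;; local_pack ;; scan ;; While rs rS round)%P.

Lemma packing_wf : cwf packing.
Proof. by vm_compute. Qed.

(** * Choosing the number of processors *)

Definition cdiv (a b : nat) := (a + b - 1) %/ b.

Lemma cdiv_le a b i : 0 < b -> (cdiv a b <= i) = (a <= i * b).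
Proof. by move=> Hb; rewrite -ltnS ltn_divLR // mulSn; lia. Qed.

Lemma cdiv_lt a b i : 0 < b -> (i < cdiv a b) = (i * b < a).
Proof. by move=> Hb; rewrite !ltnNge cdiv_le. Qed.

Lemma cdiv_ge a b : 0 < b -> a <= cdiv a b * b.
Proof. by move=> Hb; rewrite -cdiv_le. Qed.

Lemma cdiv_mul_le a b : 0 < b -> cdiv a b * b <= a + b - 1.
Proof. by move=> Hb; exact: leq_divM. Qed.

(** The values computed by the program are at most quadratic in the array length; the generous
    constants spare a separate analysis of each expression. *)
Lemma word_le E a : 100 * (len E * len E) + 100 < 2 ^ wbits E ->
  a <= 100 * (len E * len E) + 100 -> a < 2 ^ wbits E.
Proof. by move=> HB Ha; apply: leq_ltn_trans Ha HB. Qed.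

Ltac fits_tac := rewrite /=; intros; repeat split;
  match goal with H : is_true (100 * _ + 100 < _) |- _ => apply: (word_le H) end.

Section Prelude.
Variable E : setting.
Let B := 2 ^ wbits E.
Let n := len E.
Let p := par E.
Hypothesis p_gt0 : 0 < p.
Hypothesis p_le_n : p <= n.
Hypothesis B_big : 100 * (n * n) + 100 < B.

Lemma n_le_sqr : n <= n * n.
Proof. by rewrite leq_pmulr // (leq_trans p_gt0). Qed.

Definition env q S (r : nat -> nat -> nat) := forall i, i < q ->
  [/\ r i rme = i, r i rn = n, r i rq = q & r i rS = S] /\
  [/\ r i rlo = i * S, r i rhi = i * S + S & r i rzero = 0].

(** Divided by [y], the work bound reads [wrk <= 230 p - 200 p / y]. The last term pays for the next
    iteration: 30 operations on each of at most [2 p / y] processors fit into the [100 p / y]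
    released when [y] doubles. *)
Definition squaring_inv M j (s : state) :=
  let y := 2 ^ j in
  [/\ alive s = cdiv p y, cells s = M, clk s <= 30 + 40 * j,
      y * wrk s + 200 * p <= 230 * (p * y) &
      forall i, i < alive s ->
        let r := regs s in [/\ r i rme = i, r i rn = n, r i rp = p & r i rpp = p.+1] /\
        [/\ r i rx = 2 ^ y, r i ry = y & r i rzero = 0]].

Lemma pow2_lt j : 2 ^ j < 2 ^ 2 ^ j.
Proof. exact: ltn_expl. Qed.

Lemma squaring_step M j s : 2 ^ 2 ^ j <= p -> squaring_inv M j s ->
  uniform true rx rpp s /\
  wp E squaring (fun s' => squaring_inv M j.+1 (spend 1 s')) (spend 1 s).
Proof.
case: s => q r M' t w Hp [/= Hq -> Ht Hw Hr].
have Hy : 2 ^ j <= p by apply: leq_trans Hp; apply/ltnW/pow2_lt.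
have Hpp : p * p <= n * n by apply: leq_mul.
have Hn := n_le_sqr.
have Hpp' := leq_pmulr p p_gt0.
have y_gt0 : 0 < 2 ^ j by rewrite expn_gt0.
have Hqp : q <= p by rewrite Hq cdiv_le // leq_pmulr.
have Hqy : q * 2 ^ j <= 2 * p.
  by rewrite Hq; apply: leq_trans (cdiv_mul_le _ y_gt0) _; lia.
split; first by move=> i /Hr[[_ _ _ /= ->] [-> _ _]].
rewrite /squaring.
apply: wp_seq; apply: wp_set => [i /Hr[_ [Hx _ _]]|].
  fits_tac; rewrite Hx; try lia.
  by apply: leq_trans (leq_mul Hp Hp) _; lia.
apply: wp_seq; apply: wp_set => [i /Hr[_ [_ Hy' _]]|].
  by fits_tac; rewrite Hy'; lia.
apply: wp_seq; apply: wp_set => [i Hi|].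
  have [[Hm _ _ _] [_ Hy' _]] := Hr i Hi.
  have Hiy : i * (2 ^ j + 2 ^ j) <= 4 * (p * p).
    by apply: (@leq_trans (p * (2 * p))); [apply: leq_mul|]; lia.
  by fits_tac; rewrite ?Hm ?Hy'; lia.
have y'_gt0 : 0 < 2 ^ j.+1 by rewrite expn_gt0.
have Hq' : cdiv p (2 ^ j.+1) <= q.
  rewrite cdiv_le // (leq_trans (cdiv_ge p y_gt0)) // -Hq leq_mul //.
  by rewrite leq_exp2l.
exists (cdiv p (2 ^ j.+1)); split=> //= [i Hi|].
  have [[Hm _ Hp' _] [_ Hy' _]] := Hr i Hi.
  by rewrite Hm Hp' Hy' cdiv_le // expnS; lia.
rewrite mulnC in Hqy.
split=> //=; first lia.
  set W := (W in 2 ^ j.+1 * W); have HW : W <= w + 30 * q by rewrite /W; lia.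
  have := leq_mul (leqnn (2 * 2 ^ j)) HW; rewrite mulnDr expnS -!mulnA => H.
  by rewrite (mulnCA p); lia.
move=> i Hi; have [|[-> -> -> ->] [Hx Hy' ->]] := Hr i _.
  by apply: leq_trans Hi Hq'.
by rewrite Hx Hy' expnS -expnD addnn mul2n.
Qed.

(** [y <= 2 * lg p] controls the segment length and hence the time; [p < 2 ^ y] ensures that [y]
    doublings suffice for the prefix sums. *)
Definition prelude_post M (s : state) := exists y,
  let q := cdiv p y in let S := cdiv n q in
  [/\ alive s = q, cells s = M, clk s <= 100 + 40 * y & wrk s <= 400 * p] /\
  [/\ 0 < y, y <= 2 * lg p, y <= p < 2 ^ y, env q S (regs s) &
      forall i, i < q -> regs s i ra = i * S /\ regs s i rj = i * S].

Lemma squaring_exit M (Q : state -> Prop) N s :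
  p < 2 ^ 2 ^ N -> (forall j, j < N -> 2 ^ 2 ^ j <= p) -> squaring_inv M N s ->
  (forall s', prelude_post M s' -> Q s') ->
  wp E (rq ::= (!rp + !ry - #1) / !ry ;;
  rS ::= (!rn + !rq - #1) / !rq ;;
  rlo ::= !rme * !rS ;;
  rhi ::= !rlo + !rS ;;
  ra ::= !rlo ;;
  rj ::= !rlo)%P Q (spend 2 s).
Proof.
move=> HN Hmin; case: s => q r M' t w [/= Hq -> Ht Hw Hr] HQ.
have y_gt0 : 0 < 2 ^ N by rewrite expn_gt0.
have [Hylg Hyp] : 2 ^ N <= 2 * lg p /\ 2 ^ N <= p.
  (* For [N = 0] the floor 1 in [lg] suffices. Otherwise minimality at the predecessor gives
     [2 ^ 2 ^ N <= p], so [2 ^ N] is at most the logarithm of [p], and one more doubling costs the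
     factor 2. *)
  case: N HN Hmin {Hq Ht Hw Hr y_gt0} => [|N] _ Hmin.
    by split; last exact: p_gt0; rewrite muln_gt0 leq_max.
  have HN := Hmin N (ltnSn N); rewrite expnS; split.
    by rewrite leq_mul2l leq_max (trunc_log_max _ HN) // orbT.
  apply: leq_trans HN; rewrite -[2 in X in X * _]expn1 -expnD leq_exp2l // add1n.
  exact: ltn_expl.
have Hn := n_le_sqr.
have q_gt0 : 0 < q by rewrite Hq cdiv_lt // mul0n.
have Hqp : q <= p by rewrite Hq cdiv_le // leq_pmulr.
set S := cdiv n q.
have HSq : S * q <= n + q - 1 := cdiv_mul_le n q_gt0.
have HS : S <= n by rewrite /S cdiv_le // leq_pmulr.
have HSi i : i < q -> i * S <= S * q by move=> Hi; rewrite mulnC leq_mul2l ltnW ?orbT.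
apply: wp_seq; apply: wp_set => [i Hi|].
  have [[Hm Hn' Hp' _] [_ Hy' _]] := Hr i Hi.
  fits_tac; rewrite ?Hy' ?Hp'; try lia.
  by apply: leq_trans (leq_div _ _) _; lia.
apply: wp_seq; apply: wp_set => [i Hi|].
  have [[Hm Hn' Hp' _] [_ Hy' _]] := Hr i Hi.
  fits_tac; rewrite ?Hy' ?Hp' ?Hn' -/(cdiv p (2 ^ N)) -?Hq; try lia.
  by rewrite -/(cdiv n q); lia.
apply: wp_seq; apply: wp_set => [i Hi|].
  have [[Hm Hn' Hp' _] [_ Hy' _]] := Hr i Hi.
  fits_tac; rewrite ?Hy' ?Hp' ?Hn' ?Hm -/(cdiv p (2 ^ N)) -?Hq -/(cdiv n q) -/S; try lia.
  by have := HSi i Hi; lia.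
apply: wp_seq; apply: wp_set => [i Hi|].
  have [[Hm Hn' Hp' _] [_ Hy' _]] := Hr i Hi.
  fits_tac; rewrite ?Hy' ?Hp' ?Hn' ?Hm -/(cdiv p (2 ^ N)) -?Hq -/(cdiv n q) -/S; try lia.
    by have := HSi i Hi; lia.
  by have := HSi i Hi; lia.
apply: wp_seq; apply: wp_set => [i Hi|].
  have [[Hm Hn' Hp' _] [_ Hy' _]] := Hr i Hi.
  fits_tac; rewrite ?Hy' ?Hp' ?Hn' ?Hm -/(cdiv p (2 ^ N)) -?Hq -/(cdiv n q) -/S; try lia.
  by have := HSi i Hi; lia.
apply: wp_set => [i Hi|].
  have [[Hm Hn' Hp' _] [_ Hy' _]] := Hr i Hi.
  fits_tac; rewrite ?Hy' ?Hp' ?Hn' ?Hm -/(cdiv p (2 ^ N)) -?Hq -/(cdiv n q) -/S; try lia.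
  by have := HSi i Hi; lia.
apply: HQ; exists (2 ^ N); rewrite -Hq; split; split; rewrite ?Hyp //=.
(* [N < 2 ^ N] turns the [40 * N] steps of the loop into [40 * y]. *)
- by have := ltn_expl N (isT : 1 < 2); lia.
- have Hw' : w <= 230 * p by rewrite -(leq_pmul2l y_gt0); lia.
  by lia.
- move=> i Hi; have [[Hm Hn' Hp' _] [_ Hy' Hz]] := Hr i Hi.
  by rewrite /= Hm Hp' Hn' Hy' Hz -/(cdiv p (2 ^ N)) -Hq -/(cdiv n q) -/S.
- move=> i Hi; have [[Hm Hn' Hp' _] [_ Hy' Hz]] := Hr i Hi.
  by rewrite /= Hm Hp' Hn' Hy' -/(cdiv p (2 ^ N)) -Hq -/(cdiv n q) -/S.
Qed.

Lemma prelude_spec M r (Q : state -> Prop) :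
  (forall s, prelude_post M s -> Q s) -> wp E prelude Q (State p r M 0 0).
Proof.
move=> HQ; have Hn := n_le_sqr.
have [N HN Hmin] : exists2 N, p < 2 ^ 2 ^ N & forall j, j < N -> 2 ^ 2 ^ j <= p.
  have Hex : exists N, p < 2 ^ 2 ^ N.
    by exists p; apply: leq_trans (pow2_lt p); apply/ltnW; rewrite ltnS ltn_expl.
  exists (ex_minn Hex); case: ex_minnP => N HN Hmin // j Hj.
  by rewrite leqNgt; apply/negP => /Hmin; rewrite leqNgt Hj.
apply: wp_seq; apply: wp_set => [i Hi|]; first by fits_tac; lia.
do 6! [apply: wp_seq; apply: wp_set => [i Hi|]; first by fits_tac; lia].
apply: wp_seq; apply: (wp_while (Inv := squaring_inv M) (N := N)).
- split=> //=.
  + by rewrite /cdiv addnK divn1.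
  + by rewrite mul1n muln1; lia.
  + by move=> i _; rewrite addn1.

- by move=> j s Hj; apply: squaring_step; apply: Hmin.
move=> s Hs; split; last exact: squaring_exit Hs HQ.
case: Hs => _ _ _ _ H i /H[[_ _ _ ->] [-> _ _]].
by apply/negbTE; rewrite -leqNgt.
Qed.
End Prelude.

(** * Packing the segments and prefix sums *)

Definition shuffle n (M M' : nat -> nat) := perm_eq (mkseq M' n) (mkseq M n).

Lemma shuffle_bounded n M M' b : shuffle n M M' ->
  (forall a, a < n -> M a < b) -> forall a, a < n -> M' a < b.
Proof.
move=> Hs HM a Ha.
have : M' a \in mkseq M' n by apply: map_f; rewrite mem_iota.
by rewrite (perm_mem Hs) => /mapP[c]; rewrite mem_iota => Hc ->; apply: HM.
Qed.

Lemma store_ext q (m : pred nat) (ad ad' vl vl' c c' : nat -> nat) :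
  (forall i, i < q -> m i -> ad i = ad' i) -> (forall i, i < q -> m i -> vl i = vl' i) ->
  c =1 c' -> store q m ad vl c =1 store q m ad' vl' c'.
Proof.
move=> Had Hvl Hc a; rewrite /store.
rewrite (eq_in_find (a2 := fun i => m i && (ad' i == a))) => [|i]; last first.
  by rewrite mem_iota => Hi; case: (boolP (m i)) => // Hm; rewrite Had.
case: ifP => // Hq; apply: Hvl => //.
have Hh : has (fun i => m i && (ad' i == a)) (iota 0 q) by rewrite has_find size_iota.
by have := nth_find 0 Hh; rewrite nth_iota // add0n => /andP[].
Qed.

(** * Simultaneous exchanges of disjoint pairs of cells *)

Section Swap.
Variables (n q : nat) (m : pred nat) (x y : nat -> nat).
Hypotheses (x_lt : forall i, i < q -> m i -> x i < n)
           (y_lt : forall i, i < q -> m i -> y i < n)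
           (x_inj : inj_on q m x) (y_inj : inj_on q m y)
           (xy : forall i j, i < q -> j < q -> m i -> m j -> x i = y j -> i = j).

(** [xy] forbids overlaps between different pairs but allows [x i = y i], which occurs in the local
    packing when [ra] equals [rj]. *)
Definition swap (M : nat -> nat) : nat -> nat :=
  store q m y (fun i => M (x i)) (store q m x (fun i => M (y i)) M).

Lemma swap_y M i : i < q -> m i -> swap M (y i) = M (x i).
Proof. by move=> Hi Hm; rewrite /swap (store_hit _ _ Hi Hm y_inj). Qed.

Lemma swap_x M i : i < q -> m i -> swap M (x i) = M (y i).
Proof.
move=> Hi Hm; case: (eqVneq (x i) (y i)) => [Heq|Hne].
  by rewrite -Heq {1}Heq swap_y.
rewrite /swap store_miss ?(store_hit _ _ Hi Hm x_inj) // => j Hj Hmj Hji.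
by move: Hne; rewrite -Hji (xy Hi Hj Hm Hmj (esym Hji)) eqxx.
Qed.

Lemma swap_other M a : (forall i, i < q -> m i -> x i <> a /\ y i <> a) -> swap M a = M a.
Proof. by move=> H; rewrite /swap !store_miss // => i Hi /(H i Hi)[]. Qed.

Lemma swap_cases a : (exists2 i, i < q & m i /\ (x i = a \/ y i = a)) \/
  (forall i, i < q -> m i -> x i <> a /\ y i <> a).
Proof.
case: (boolP (has (fun i => m i && ((x i == a) || (y i == a))) (iota 0 q))).
  case/hasP=> i; rewrite mem_iota add0n => Hi /andP[Hm H]; left; exists i => //.
  by split=> //; case/orP: H => /eqP; [left|right].
move/hasPn=> H; right=> i Hi Hm; have := H i; rewrite mem_iota Hi Hm => /(_ isT).
by rewrite negb_or => /andP[/eqP ? /eqP ?].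
Qed.

(** [swap id] is an involution on the indices below [n], and [swap M] is [M] composed with it. *)
Lemma swap_shuffle M : shuffle n M (swap M).
Proof.
have Hcomp a : swap M a = M (swap id a).
  by rewrite /swap /store; case: ifP => // _; case: ifP.
have Hinv a : swap id (swap id a) = a.
  case: (swap_cases a) => [[i Hi [Hm [<-|<-]]]|H].
  - by rewrite (swap_x _ Hi Hm) (swap_y _ Hi Hm).
  - by rewrite (swap_y _ Hi Hm) (swap_x _ Hi Hm).
  by rewrite !(swap_other _ H).
have Hlt a : a < n -> swap id a < n.
  move=> Ha; case: (swap_cases a) => [[i Hi [Hm [<-|<-]]]|H].
  - by rewrite swap_x //; apply: y_lt.
  - by rewrite swap_y //; apply: x_lt.
  by rewrite (swap_other _ H).
rewrite /shuffle /mkseq (eq_map Hcomp) map_comp; apply: perm_map.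
apply: uniq_perm; rewrite ?iota_uniq ?map_inj_uniq ?iota_uniq //; first exact: can_inj Hinv.
move=> a; rewrite mem_iota add0n /=; apply/mapP/idP => [[b]|Ha].
  by rewrite mem_iota => /= /Hlt ? ->.
by exists (swap id a); rewrite ?Hinv // mem_iota /= Hlt.
Qed.
End Swap.

(** * Sequential packing inside each segment *)

Section Segments.
Variable E : setting.
Let B := 2 ^ wbits E.
Let n := len E.
Let lab := label E.
Hypothesis B_big : 100 * (n * n) + 100 < B.
Variables q S : nat.
Hypotheses (q_gt0 : 0 < q) (q_le_n : q <= n) (n_le_qS : n <= q * S) (qS_le : q * S <= 2 * n).
Variable M0 : nat -> nat.
Hypothesis M0_lt : forall a, a < n -> M0 a < B.

Lemma S_gt0 : 0 < S.
Proof.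
case: S n_le_qS => // n0; have := leq_trans q_gt0 (leq_trans q_le_n n0).
by rewrite muln0.
Qed.

Lemma seg_le i : i < q -> i * S + S <= 2 * n.
Proof. by move=> Hi; rewrite addnC -mulSn; apply: leq_trans qS_le; apply: leq_mul. Qed.

(** Both indices are [a %/ S]. This disjointness of the segments makes the accesses of the local
    packing exclusive. *)
Lemma seg_inj i j a : i * S <= a < i * S + S -> j * S <= a < j * S + S -> i = j.
Proof.
have H k : k * S <= a < k * S + S -> a %/ S = k.
  by move=> Hk; rewrite -(subnKC (proj1 (andP Hk))) divnMDl ?S_gt0 // divn_small ?addn0 //; lia.
by move=> /H <- /H.
Qed.

(** From here on [q] processors stay alive, so a single step count [d] accounts for both clock and
    work. *)
Definition spent t0 w0 b (s : state) :=
  exists2 d, d <= b & clk s = t0 + d /\ wrk s = w0 + d * q.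

Lemma spent_add t0 w0 b b' d t w k (s : state) :
  d <= b -> t = t0 + d -> w = w0 + d * q -> clk s = t + k -> wrk s = w + k * q ->
  b + k <= b' -> spent t0 w0 b' s.
Proof.
move=> Hd -> -> Ht Hw Hb; exists (d + k); first by apply: leq_trans Hb; rewrite leq_add2r.
by rewrite Ht Hw mulnDl !addnA.
Qed.

(** A segment may start beyond the array; then [a] never moves, whence the alternative [a = i * S]
    to [a <= n]. *)
Definition pack_inv t0 w0 jj (s : state) :=
  [/\ alive s = q, shuffle n M0 (cells s), env E q S (regs s),
      spent t0 w0 (60 * jj) s &
      forall i, i < q ->
        let a := regs s i ra in let j := regs s i rj in
        [/\ j = i * S + jj, i * S <= a <= j, a = i * S \/ a <= n &
            forall g, i * S <= g < j -> g < n -> lab (cells s g) = (g < a)]].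

Lemma pack_step_spec t0 w0 jj s : jj < S -> pack_inv t0 w0 jj s ->
  uniform true rj rhi s /\
  wp E pack_step (fun s' => pack_inv t0 w0 jj.+1 (spend 1 s')) (spend 1 s).
Proof.
case: s => q' r M t w Hjj [/= -> Hsh Henv [d Hd [/= Ht Hw]] Hr].
have HM := shuffle_bounded Hsh M0_lt.
have Hn : n <= n * n by rewrite leq_pmulr // (leq_trans q_gt0).
split.
  move=> i Hi /=; have [-> _ _ _] := Hr i Hi; have [_ [_ -> _]] := Henv i Hi.
  by rewrite ltn_add2l.
apply: wp_seq; apply: wp_set => [i Hi|]; first by fits_tac.
apply: wp_seq; apply: wp_if; rewrite /=.
apply: wpb_load => [i Hi /= Hm|i j Hi Hj /= Hmi Hmj|].
- have [[_ Hn' _ _] _] := Henv i Hi; rewrite Hn' in Hm.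
  by split=> //; apply: HM.
- have [-> Ha _ _] := Hr i Hi; have [-> Ha' _ _] := Hr j Hj => H.
  by apply: (@seg_inj _ _ (i * S + jj)); lia.
apply: wpb_label; apply: wpb_load => [i Hi /= Hm|i j Hi Hj /= Hmi Hmj|].
- have [[_ Hn' _ _] _] := Henv i Hi; rewrite Hn' in Hm.
  have [Hj Ha Ha' _] := Hr i Hi; have : r i ra < n by rewrite /n; lia.
  by split=> //; apply: HM.
- have [Hj' Ha _ _] := Hr i Hi; have [Hj'' Ha' _ _] := Hr j Hj => H.
  by apply: (@seg_inj _ _ (r i ra)); lia.
apply: wpb_nil; rewrite /=.
apply: wp_seq; apply: wp_if; rewrite /=.
set m := fun i => r i rzero < _.
have Hm i : i < q -> m i = (r i rj < n) && lab (M (r i rj)).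
  move=> Hi; rewrite /m; have [[_ -> _ _] [_ _ ->]] := Henv i Hi.
  by rewrite -/n -/lab; case: (ltnP (r i rj) n) => //= _; case: lab.
have Hseg i : i < q -> i * S <= r i ra < i * S + S /\ i * S <= r i rj < i * S + S.
  by move=> Hi; have [-> Ha _ _] := Hr i Hi; lia.
have Ha_lt i : i < q -> m i -> r i ra < n.
  by move=> Hi; rewrite Hm // => /andP[Hj _]; have [_ Ha _ _] := Hr i Hi; lia.
have Hj_lt i : i < q -> m i -> r i rj < n.
  by move=> Hi; rewrite Hm // => /andP[].
have Ha_inj : inj_on q m (fun i => r i ra).
  move=> i j Hi Hj _ _ H; apply: (@seg_inj _ _ (r i ra)); first exact: (Hseg i Hi).1.
  by rewrite H; exact: (Hseg j Hj).1.
have Hj_inj : inj_on q m (fun i => r i rj).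
  move=> i j Hi Hj _ _ H; apply: (@seg_inj _ _ (r i rj)); first exact: (Hseg i Hi).2.
  by rewrite H; exact: (Hseg j Hj).2.
have Haj i j : i < q -> j < q -> m i -> m j -> r i ra = r j rj -> i = j.
  move=> Hi Hj _ _ H; apply: (@seg_inj _ _ (r i ra)); first exact: (Hseg i Hi).1.
  by rewrite H; exact: (Hseg j Hj).2.
apply: wpb_store => //=; apply: wpb_store => //=; apply: wpb_nil => /=.
set M' := store q m _ _ _.
have HM' g : M' g = swap q m (fun i => r i ra) (fun i => r i rj) M g.
  apply: store_ext => // [i Hi|]; last apply: store_ext => // i Hi;
    by move=> /(Hj_lt i Hi); have [[_ -> _ _] _] := Henv i Hi; rewrite -/n => ->.
apply: wp_seq; apply: wp_set => [i Hi|].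
  have [Hj Ha _ _] := Hr i Hi; have := seg_le Hi.
  have Hb (c b : bool) : (if c then nat_of_bool b else 0) <= 1 by case: c; case: b.
  by fits_tac; rewrite ?(leq_trans (Hb _ _)) //; try lia; rewrite (leq_trans (leq_add (leqnn _) (Hb _ _))) //; lia.
apply: wp_set => [i Hi|].
  by have [Hj Ha _ _] := Hr i Hi; have := seg_le Hi; fits_tac; lia.
have Hw_inj := swap_shuffle Ha_lt Hj_lt Ha_inj Hj_inj Haj M.
split=> //=.
- apply: perm_trans Hsh; rewrite -[X in perm_eq _ X]/(mkseq M n).
  by rewrite (eq_mkseq (g := swap q m (fun i => r i ra) (fun i => r i rj) M)).
- by apply: (spent_add (k := 27) Hd Ht Hw) => /=; lia.
move=> i Hi; have [[_ Hn' _ _] _] := Henv i Hi.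
have [Hj Ha Han Hlab] := Hr i Hi; rewrite Hn' -/n -/lab.
have Hoth g : i * S <= g < i * S + S -> g <> r i ra -> g <> r i rj -> M' g = M g.
  move=> Hg Hga Hgj; rewrite HM' swap_other // => k Hk _.
  have [Hka Hkj] := Hseg k Hk.
  by split=> Heq; [apply: Hga|apply: Hgj]; rewrite -Heq; congr (r _ _);
     apply: (@seg_inj _ _ g) => //; rewrite -Heq.
have Hidle g : ~~ m i -> i * S <= g < i * S + S -> M' g = M g.
  move=> Hni Hg; rewrite HM' swap_other // => k Hk Hmk; have [Hka Hkj] := Hseg k Hk.
  suff Hne : i <> k.
    by split=> Heq; apply: Hne; apply: (@seg_inj _ _ g); rewrite -?Heq //; lia.
  by move=> Hik; move: Hmk; rewrite -Hik (negbTE Hni).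
rewrite Hm // in Hidle.
case: (ltnP (r i rj) n) => Hjn in Hidle *; last first.
  rewrite addn0; split=> //; try lia.
  move=> g Hg Hgn; rewrite Hidle // ?Hlab //; lia.
case Hl: (lab _) => /= in Hidle *; last first.
  rewrite addn0; split=> //; try lia.
  move=> g Hg Hgn; rewrite Hidle //; last by lia.
  case: (ltngtP g (r i rj)) => Hgj; [by rewrite Hlab //; lia|lia|].
  by rewrite Hgj Hl; lia.
have Hmi : m i by rewrite Hm // Hjn Hl.
split=> //; try lia.
move=> g Hg Hgn.
case: (eqVneq g (r i ra)) => [->|Hga].
  rewrite HM' (swap_x Ha_inj Hj_inj Haj M Hi Hmi) Hl; lia.
(* If [g] is [rj] but not [ra], then [ra < rj], and the invariant at [ra] says that the element
   moved to [rj] is a zero. *)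
case: (eqVneq g (r i rj)) => [Hgj|Hgj].
  rewrite Hgj HM' (swap_y _ Hj_inj M Hi Hmi) Hlab //; lia.
rewrite Hoth; [rewrite Hlab //; lia|lia|exact/eqP|exact/eqP].
Qed.

Definition packed (f M : nat -> nat) := forall i, i < q ->
  [/\ f i <= S, f i = 0 \/ i * S + f i <= n &
      forall g, i * S <= g < i * S + S -> g < n -> lab (M g) = (g < i * S + f i)].

Lemma local_pack_spec t0 w0 s (Q : state -> Prop) : pack_inv t0 w0 0 s ->
  (forall s' f, [/\ alive s' = q, shuffle n M0 (cells s'), env E q S (regs s'),
     spent t0 w0 (60 * S + 2) s' & packed f (cells s')] ->
     (forall i, i < q -> regs s' i ra = i * S + f i) -> Q s') ->
  wp E local_pack Q s.
Proof.
move=> H0 HQ; apply: (wp_while H0 (N := S)) => [jj s'|s'].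
  exact: pack_step_spec.
case: s' => q' r M t w [/= -> Hsh Henv [d Hd [/= Ht Hw]] Hr]; split.
  move=> i Hi /=; have [-> _ _ _] := Hr i Hi; have [_ [_ -> _]] := Henv i Hi.
  by rewrite ltnn.
apply: (HQ _ (fun i => r i ra - i * S)) => /= [|i Hi]; last first.
  by have [_ Ha _ _] := Hr i Hi; lia.
split=> //; first by apply: (spent_add (k := 2) Hd Ht Hw).
move=> i Hi; have [Hj Ha Han Hlab] := Hr i Hi.
have Heq : i * S + (r i ra - i * S) = r i ra by lia.
rewrite Heq; split; [lia|case: Han => Han; [left|right]; lia|].
by move=> g Hg; apply: Hlab; rewrite Hj.
Qed.

(** * Prefix and suffix sums by doubling *)

Section Scan.
Variables (f M : nat -> nat).
Hypothesis f_le : forall i, i < q -> f i <= S.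
Hypothesis M_lt : forall a, a < n -> M a < B.

Definition psum i := \sum_(0 <= k < i) f k.

Lemma sum_le a b : b <= q -> \sum_(a <= k < b) f k <= (b - a) * S.
Proof.
move=> Hb; rewrite -sum_nat_const_nat !big_nat; apply: leq_sum => k /andP[_ Hk].
exact/f_le/(leq_trans Hk).
Qed.

Lemma sum_word a b : b <= q -> \sum_(a <= k < b) f k <= 2 * n.
Proof.
move=> Hb; apply: leq_trans (sum_le _ Hb) _; apply: leq_trans qS_le.
by apply: leq_mul => //; lia.
Qed.

(** The windows are cut by truncated subtraction at 0 and by [minn] at [q]. The first [q] cells are
    scratch and left unconstrained; [rst] keeps their elements. *)
Definition scan_inv t0 w0 b0 e (s : state) :=
  [/\ alive s = q, forall a, q <= a -> cells s a = M a, env E q S (regs s),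
      spent t0 w0 (b0 + 60 * e) s &
      forall i, i < q -> let r := regs s i in
        [/\ r ra = i * S + f i, r rf = f i, r rst = M i & r rme1 = i.+1] /\
        [/\ r rd = 2 ^ e, r rv = \sum_(i.+1 - 2 ^ e <= k < i.+1) f k &
            r ru = \sum_(i <= k < minn q (i + 2 ^ e)) f k]].

Lemma scan_step_spec t0 w0 b0 e s : 2 ^ e < q -> scan_inv t0 w0 b0 e s ->
  uniform true rd rq s /\
  wp E scan_step (fun s' => scan_inv t0 w0 b0 e.+1 (spend 1 s')) (spend 1 s).
Proof.
case: s => q' r M' t w Hdq [/= -> HM Henv [d Hd [/= Ht Hw]] Hr].
have Hn : n <= n * n by rewrite leq_pmulr // (leq_trans q_gt0).
split.
  by move=> i Hi /=; have [_ [-> _ _]] := Hr i Hi; have [[_ _ -> _] _] := Henv i Hi.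
have Hme i : i < q -> r i rme = i by move=> /Henv[[]].
have Hinj : inj_on q xpredT (fun i => r i rme).
  by move=> i j Hi Hj _ _; rewrite !Hme.
have Hlt i : i < q -> r i rme < len E.
  by move=> Hi; rewrite Hme // (leq_trans Hi).
have Hv i : i < q -> r i rv <= 2 * n.
  by move=> Hi; have [_ [_ -> _]] := Hr i Hi; apply: sum_word.
have Hu i : i < q -> r i ru <= 2 * n.
  by move=> Hi; have [_ [_ _ ->]] := Hr i Hi; apply: sum_word; exact: geq_minl.
have Hd_ i : i < q -> r i rd = 2 ^ e by move=> /Hr[_ []].
apply: wp_seq; apply: wp_store => //; set M1 := store _ _ _ _ _.
have HM1 i : i < q -> M1 i = r i rv.
  by move=> Hi; rewrite -{1}(Hme i Hi) /M1 store_hit.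
apply: wp_seq; apply: wp_set => [i Hi|].
  by fits_tac; rewrite ?Hme ?Hd_ //; lia.
apply: wp_seq; apply: wp_if; rewrite /=.
set m := fun i => r i rd < _.
have Hm i : i < q -> m i = (2 ^ e <= i).
  by move=> Hi; rewrite /m Hd_ //; have [[_ _ _ ->] _] := Hr i Hi.
apply: wpb_load => [i Hi|i j Hi Hj|].
- rewrite Hm // => /= Hi'; rewrite Hme // Hd_ // HM1; last by lia.
  split; first by apply: leq_trans q_le_n; lia.
  by apply: (word_le B_big); have := Hv (i - 2 ^ e); lia.
- by rewrite !Hm //= !Hme // !Hd_ //; lia.
have Hw1 i : i < q -> m i -> M1 (r i rme - r i rd) = r (i - 2 ^ e) rv.
  by move=> Hi; rewrite Hm // Hme // Hd_ // => Hi'; apply: HM1; lia.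
apply: wpb_set => [i Hi Hmi|].
  fits_tac; rewrite ?Hmi ?Hw1 //; rewrite Hm // in Hmi.
  - by have := Hv i Hi; lia.
  - by have := Hv (i - 2 ^ e); lia.
  by have := Hv i Hi; have := Hv (i - 2 ^ e); lia.
apply: wpb_nil => /=.
apply: wp_seq; apply: wp_store => //=; set M2 := store _ _ _ _ _.
have HM2 i : i < q -> M2 i = r i ru.
  by move=> Hi; rewrite -{1}(Hme i Hi) /M2 store_hit.
apply: wp_seq; apply: wp_set => [i Hi|].
  by fits_tac; rewrite ?Hme ?Hd_ //; lia.
apply: wp_seq; apply: wp_if; rewrite /=.
set m' := fun i => r i rme + r i rd < _.
have Hm' i : i < q -> m' i = (i + 2 ^ e < q).
  by move=> Hi; rewrite /m' Hd_ // Hme //; have [[_ _ -> _] _] := Henv i Hi.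
apply: wpb_load => [i Hi|i j Hi Hj|].
- rewrite Hm' // => /= Hi'; rewrite Hme // Hd_ // HM2 //.
  split; first exact: leq_trans q_le_n.
  by apply: (word_le B_big); have := Hu _ Hi'; lia.
- by rewrite !Hm' //= !Hme // !Hd_ //; lia.
have Hw2 i : i < q -> m' i -> M2 (r i rme + r i rd) = r (i + 2 ^ e) ru.
  by move=> Hi; rewrite Hm' // Hme // Hd_ // => Hi'; apply: HM2.
apply: wpb_set => [i Hi Hmi|].
  fits_tac; rewrite ?Hmi ?Hw2 //; rewrite Hm' // in Hmi.
  - by have := Hu i Hi; lia.
  - by have := Hu _ Hmi; lia.
  by have := Hu i Hi; have := Hu _ Hmi; lia.
apply: wpb_nil => /=.
apply: wp_set => [i Hi|].
  by fits_tac; rewrite ?Hd_ //; lia.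
split=> //=.
- move=> a Ha; rewrite /M2 store_miss => [|i Hi _]; last by rewrite Hme //; lia.
  by rewrite /M1 store_miss ?HM // => i Hi _; rewrite Hme //; lia.
- by apply: (spent_add (k := 45) Hd Ht Hw) => /=; lia.
move=> i Hi; have [[-> -> -> ->] [-> Hvi Hui]] := Hr i Hi.
split=> //; split; first by rewrite expnS; lia.
- case: (boolP (m i)) => Hmi; last first.
    (* Without a partner at distance [2 ^ e] the window already starts at 0, and doubling it changes
       nothing. *)
    rewrite Hvi; rewrite Hm // in Hmi.
    have -> : i.+1 - 2 ^ e = 0 by lia.
    by have -> : i.+1 - 2 ^ e.+1 = 0 by rewrite expnS; lia.
  rewrite Hm // in Hmi; have Hi' : i - 2 ^ e < q by lia.
  rewrite Hme // HM1 // Hvi.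
  have [_ [_ -> _]] := Hr _ Hi'.
  rewrite addnC -subSn // [RHS](big_cat_nat (n := i.+1 - 2 ^ e)) /=; try lia; last first.
    by rewrite expnS; lia.
  by congr (_ + _); congr (\sum_(_ <= k < _) _); rewrite expnS; lia.
case: (boolP (m' i)) => Hmi; last first.
  rewrite Hui; rewrite Hm' // in Hmi.
  by congr (\sum_(_ <= k < _) _); rewrite expnS; lia.
rewrite Hm' // in Hmi; rewrite Hme // HM2 // Hui.
have [_ [_ _ ->]] := Hr _ Hmi.
rewrite [RHS](big_cat_nat (n := i + 2 ^ e)) /=; try (rewrite ?expnS; lia).
congr (_ + _); congr (\sum_(_ <= k < _) _); rewrite ?expnS; lia.
Qed.

Definition scan_post t0 w0 b (s : state) :=
  [/\ alive s = q, cells s =1 M, env E q S (regs s), spent t0 w0 b s &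
      forall i, i < q -> let r := regs s i in
        [/\ r ra = i * S + f i, r rf = f i & r rm = psum q] /\
        [/\ r rrho = i * S - psum i, r rsg = psum q - psum i.+1 & r rs = 0]].

Lemma scan_spec t0 w0 b N s (Q : state -> Prop) :
  q <= 2 ^ N -> (forall e, e < N -> 2 ^ e < q) ->
  alive s = q -> cells s = M -> env E q S (regs s) -> spent t0 w0 b s ->
  (forall i, i < q -> regs s i ra = i * S + f i) ->
  (forall s', scan_post t0 w0 (b + 60 * N + 100) s' -> Q s') ->
  wp E scan Q s.
Proof.
case: s => q' r M' t w HN Hmin /= -> -> Henv [d Hd [/= Ht Hw]] Hr HQ.
have Hn : n <= n * n by rewrite leq_pmulr // (leq_trans q_gt0).
have Hme i : i < q -> r i rme = i by move=> /Henv[[]].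
have Hlo i : i < q -> r i rlo = i * S by move=> /Henv[_ []].
apply: wp_seq; apply: wp_set => [i Hi|].
  by have := seg_le Hi; have := f_le Hi; fits_tac; rewrite ?Hr ?Hlo //; lia.
apply: wp_seq; apply: wp_load => [i Hi /=|i j Hi Hj _ _ /=|].
- by rewrite Hme //; have Hin := leq_trans Hi q_le_n; split=> //; apply: M_lt.
- by rewrite !Hme.
apply: wp_seq; apply: wp_set => [i Hi|]; first by fits_tac; lia.
apply: wp_seq; apply: wp_set => [i Hi|].
  by have := seg_le Hi; have := f_le Hi; fits_tac; rewrite ?Hr ?Hlo //; lia.
apply: wp_seq; apply: wp_set => [i Hi|].
  by have := seg_le Hi; have := f_le Hi; fits_tac; rewrite ?Hr ?Hlo //; lia.
apply: wp_seq; apply: wp_set => [i Hi|]; first by fits_tac; rewrite ?Hme //; lia.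
apply: wp_seq; apply: (wp_while (Inv := scan_inv t0 w0 (b + 50)) (N := N)) => [|e s1 He|].
- split=> //=; first by apply: (spent_add (k := 25) Hd Ht Hw) => /=; lia.
  move=> i Hi; rewrite Hr // Hlo // Hme // addKn addn1 subSS subn0.
  by have -> : minn q i.+1 = i.+1; [lia | rewrite !big_nat1].
- exact/scan_step_spec/Hmin.
case=> q2 r2 M2 t2 w2 [/= -> HM Henv2 [d2 Hd2 [/= Ht2 Hw2]] Hr2]; split.
  move=> i Hi /=; have [_ [-> _ _]] := Hr2 i Hi; have [[_ _ -> _] _] := Henv2 i Hi.
  by rewrite ltnNge HN.
have Hme2 i : i < q -> r2 i rme = i by move=> /Henv2[[]].
have Hlo2 i : i < q -> r2 i rlo = i * S by move=> /Henv2[_ []].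
have Hv i : i < q -> r2 i rv = psum i.+1.
  move=> Hi; have [_ [_ -> _]] := Hr2 i Hi.
  by have -> : i.+1 - 2 ^ N = 0 by lia.
have Hu i : i < q -> r2 i ru = \sum_(i <= k < q) f k.
  move=> Hi; have [_ [_ _ ->]] := Hr2 i Hi.
  by have -> : minn q (i + 2 ^ N) = q by lia.
have Hf i : i < q -> r2 i rf = f i by move=> /Hr2[[]].
have Hps i : psum i.+1 = psum i + f i by rewrite /psum big_nat_recr.
(* The prefix up to [i] and the suffix from [i] overlap exactly in [f i]. *)
have Htot i : i < q -> psum i.+1 + \sum_(i <= k < q) f k = psum q + f i.
  by move=> Hi; rewrite Hps addnAC /psum -big_cat_nat // ltnW.
have Hpq : psum q <= 2 * n by apply: sum_word.
apply: wp_seq; apply: wp_store => [i Hi /=|i j Hi Hj _ _ /=|].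
- by rewrite Hme2 // (leq_trans Hi).
- by rewrite !Hme2.
apply: wp_seq; apply: wp_set => [i Hi|].
  by have := Htot i Hi; have := f_le Hi; have := seg_le Hi;
     fits_tac; rewrite ?Hv ?Hu ?Hf //; lia.
apply: wp_seq; apply: wp_set => [i Hi|].
  by have := Htot i Hi; have := f_le Hi; have := seg_le Hi;
     fits_tac; rewrite ?Hv ?Hu ?Hf ?Hlo2 //; lia.
apply: wp_seq; apply: wp_set => [i Hi|].
  by have := Htot i Hi; have := f_le Hi; have := seg_le Hi;
     fits_tac; rewrite ?Hv ?Hu ?Hf ?Hlo2 //; lia.
apply: wp_set => [i Hi|]; first by fits_tac.
apply: HQ; split=> //=.
- move=> a; case: (ltnP a q) => Ha; last first.
    by rewrite store_miss ?HM // => i Hi _; rewrite Hme2 //; lia.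
  rewrite -{1}(Hme2 a Ha) (store_hit (m := xpredT)) //.
    by have [[_ _ -> _] _] := Hr2 a Ha.
  by move=> i j Hi Hj _ _; rewrite !Hme2.
- by apply: (spent_add (k := 33) Hd2 Ht2 Hw2) => /=; lia.
move=> i Hi; rewrite Hv // Hu // Hf // Hlo2 // Htot // addnK Hps addnK.
by have [[-> _ _ _] _] := Hr2 i Hi.
Qed.
End Scan.
End Segments.

(** * Exchange rounds *)

Definition cnt (P : pred nat) b := \sum_(0 <= k < b) P k.

Lemma cntS P b : cnt P b.+1 = cnt P b + P b.
Proof. by rewrite /cnt big_nat_recr. Qed.

Lemma cnt_mono P : {homo cnt P : a b / a <= b}.
Proof. by move=> a b Hab; rewrite /cnt [leqRHS](big_cat_nat (n := a)) //= leq_addr. Qed.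

Lemma cnt_lt (P : pred nat) a b : P a -> a < b -> cnt P a < cnt P b.
Proof. by move=> Pa /(cnt_mono P); rewrite cntS Pa addn1. Qed.

Lemma cnt_inj (P : pred nat) a b : P a -> P b -> cnt P a = cnt P b -> a = b.
Proof.
move=> Pa Pb; case: (ltngtP a b) => // Hab.
  by have := cnt_lt Pa Hab; lia.
by have := cnt_lt Pb Hab; lia.
Qed.

(** The count starts at 0 and grows by one exactly at the elements of [P], so no value is
    skipped. *)
Lemma cnt_ex (P : pred nat) b r : r < cnt P b ->
  exists g, [/\ g < b, P g & cnt P g = r].
Proof.
elim: b => [|b IH]; first by rewrite /cnt big_nil.
rewrite cntS; case: (ltnP r (cnt P b)) => [/IH[g [Hg Pg Hr]] _|Hr Hlt].
  by exists g; split=> //; exact: ltnW.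
by exists b; case: (P b) Hlt => Hlt; split=> //; lia.
Qed.

Lemma cntC P b : cnt P b + cnt (predC P) b = b.
Proof.
rewrite /cnt -big_split /= (eq_bigr (fun=> 1)) => [|k _]; last by case: (P k).
by rewrite sum_nat_const_nat subn0 muln1.
Qed.

Lemma modn_solve S r s : s < S -> (r + (s + (S - r %% S)) %% S) %% S = s.
Proof.
move=> Hs; have HS : 0 < S by lia.
rewrite modnDmr -modnDml.
have := ltn_pmod r HS => Hr.
have -> : r %% S + (s + (S - r %% S)) = s + S by lia.
by rewrite modnDr modn_small.
Qed.

(** An offset below [S] is its own remainder, so the congruence determines it; hence a segment has
    at most one zero and one one due in a given round. *)
Lemma modn_solve_uniq S r s e : e < S -> (r + e) %% S = s ->
  e = (s + (S - r %% S)) %% S.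
Proof.
move=> He <-; have HS : 0 < S by lia.
rewrite modnDml -addnA -modnDml.
have := ltn_pmod r HS => Hr.
have -> : r %% S + (e + (S - r %% S)) = e + S by lia.
by rewrite modnDr modn_small.
Qed.

(** * Pairing misplaced zeros and ones by rank *)

Section Matching.
Variables (q S : nat) (f : nat -> nat).
Hypotheses (S_gt0 : 0 < S) (f_le : forall i, i < q -> f i <= S).

(** The labelling after the local packing, read off from the counts [f]. It is total, so positions
    of the last segments beyond the array also get a label; they will count as zeros. *)
Definition is_one : pred nat := fun g => g %% S < f (g %/ S).

Let m := psum f q.

(* Misplaced zeros are ranked from the left and misplaced ones from the right;
   the exchanged pairs are those of equal rank_of. *)
Definition rank_of g := if is_one g then m.-1 - cnt is_one g else cnt (predC is_one) g.

Definition misplaced g := is_one g != (g < m).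

Lemma one_seg i k : k < S -> is_one (i * S + k) = (k < f i).
Proof.
by move=> Hk; rewrite /is_one modnMDl divnMDl // modn_small // divn_small // addn0.
Qed.

Lemma psumS i : psum f i.+1 = psum f i + f i.
Proof. by rewrite /psum big_nat_recr. Qed.

Lemma cnt_seg i k : i < q -> k <= S -> cnt is_one (i * S + k) = psum f i + minn k (f i).
Proof.
elim: i k => [|i IHi] k Hi; elim: k => [|k IHk] Hk.
- by rewrite /cnt /psum !big_nil min0n.
- by rewrite addnS cntS (IHk (ltnW Hk)) one_seg //; case: ltnP; lia.
- rewrite addn0 mulSn addnC IHi // ?psumS; last by exact: ltnW.
  have := f_le (ltnW Hi) => Hf; rewrite min0n addn0; congr (_ + _).
  by apply/minn_idPr.
by rewrite addnS cntS (IHk (ltnW Hk)) one_seg //; case: ltnP; lia.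
Qed.

Lemma cnt_all : cnt is_one (q * S) = m.
Proof.
rewrite /m; case: (q) f_le cnt_seg => [|q'] Hf Hc; first by rewrite /cnt /psum !big_nil.
by rewrite mulSn addnC Hc // psumS; congr (_ + _); apply/minn_idPr/Hf.
Qed.

Lemma rank_zero_lt g : ~~ is_one g -> rank_of g <= g.
Proof. by move=> H; rewrite /rank_of (negbTE H) -[leqRHS](cntC is_one g) leq_addl. Qed.

Lemma cnt_one_lt g : is_one g -> g < q * S -> cnt is_one g < m.
Proof. by move=> H1 Hg; rewrite -cnt_all cnt_lt. Qed.

(** With [m] ones in total, the first [m] cells contain as many zeros as there are ones beyond them.
    So misplaced zeros and misplaced ones have the same set of ranks. *)
Lemma match_one o : is_one o -> m <= o -> o < q * S ->
  exists g, [/\ g < m, ~~ is_one g & rank_of g = rank_of o].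
Proof.
move=> H1 Hm Ho; have Hlt := cnt_one_lt H1 Ho.
have Hmono := cnt_mono is_one Hm; have Hc := cntC is_one m.
have [|g [Hg Hz Hr]] := @cnt_ex (predC is_one) m (m.-1 - cnt is_one o); first by lia.
by exists g; split=> //; rewrite /rank_of H1 (negbTE Hz).
Qed.

Lemma match_zero g : ~~ is_one g -> g < m ->
  exists o, [/\ m <= o < q * S, is_one o & rank_of o = rank_of g].
Proof.
move=> Hz Hg; have Hlt := @cnt_lt (predC is_one) g m Hz Hg; have Hc := cntC is_one m.
have [|o [Ho H1 Hr]] := @cnt_ex is_one (q * S) (m.-1 - cnt (predC is_one) g).
  by rewrite cnt_all; lia.
exists o; rewrite Ho andbT /rank_of H1 (negbTE Hz) Hr; split=> //; last by lia.
by rewrite leqNgt; apply/negP => Hlt'; have := cnt_lt H1 Hlt'; lia.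
Qed.

Lemma rank_inj_zero g h : ~~ is_one g -> ~~ is_one h -> rank_of g = rank_of h -> g = h.
Proof.
move=> Hg Hh; rewrite /rank_of (negbTE Hg) (negbTE Hh).
exact: (@cnt_inj (predC is_one)).
Qed.

Lemma rank_inj_one g h : is_one g -> is_one h -> g < q * S -> h < q * S ->
  rank_of g = rank_of h -> g = h.
Proof.
move=> Hg Hh Hgq Hhq; have := cnt_one_lt Hg Hgq; have := cnt_one_lt Hh Hhq.
by rewrite /rank_of Hg Hh => ? ? ?; apply: (cnt_inj Hg Hh); lia.
Qed.

Lemma psum_mono : {homo psum f : i j / i <= j}.
Proof. by move=> i j Hij; rewrite /psum [leqRHS](big_cat_nat (n := i)) //= leq_addr. Qed.

Lemma psum_seg i : i <= q -> psum f i <= i * S.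
Proof.
elim: i => [|i IH] Hi; first by rewrite /psum big_nil.
by rewrite psumS mulSn; have := IH (ltnW Hi); have := f_le Hi; lia.
Qed.

(** The zeros of segment [i] have consecutive ranks from [i * S - psum f i] on; this is how far past
    its first zero the rank is congruent to [s] modulo [S]. *)
Definition zero_off i s := (s + (S - (i * S - psum f i) %% S)) %% S.
Definition zero_pos i s := i * S + f i + zero_off i s.
Definition zero_act i s := (zero_pos i s < i * S + S) && (zero_pos i s < m).

(** Ones are ranked from the right, so [m - psum f i.+1] is the rank of the last one of segment [i],
    and the offset is counted backwards from it. The [.-1] in [one_pos] is there because
    [i * S + f i] is one past that element. *)
Definition one_off i s := (s + (S - (m - psum f i.+1) %% S)) %% S.
Definition one_pos i s := (i * S + f i - one_off i s).-1.
Definition one_act i s := (one_off i s < f i) && (m <= one_pos i s).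

Lemma zero_actP i s : i < q -> s < S -> zero_act i s ->
  let z := zero_pos i s in
  [/\ ~~ is_one z, z < m, z %/ S = i, rank_of z = i * S - psum f i + zero_off i s & rank_of z %% S = s].
Proof.
move=> Hi Hs /andP[Hz1 Hz2] /=.
have Hk : f i + zero_off i s < S by move: Hz1; rewrite /zero_pos -addnA ltn_add2l.
have Hne : ~~ is_one (zero_pos i s).
  by rewrite /zero_pos -addnA one_seg // -leqNgt leq_addr.
have Hrk : rank_of (zero_pos i s) = i * S - psum f i + zero_off i s.
  rewrite /rank_of (negbTE Hne); have := cntC is_one (zero_pos i s).
  rewrite {1}/zero_pos -addnA cnt_seg //; last exact: ltnW.
  have := psum_seg (ltnW Hi); rewrite (minn_idPr (leq_addr _ _)) /zero_pos; lia.
split=> //; first by rewrite /zero_pos -addnA divnMDl // divn_small // addn0.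
by rewrite Hrk modn_solve.
Qed.

(** Every misplaced zero gets a turn: its distance from the first zero of the segment is below [S],
    hence is the unique solution of the congruence for the residue of its rank. *)
Lemma zero_act_ex g : ~~ is_one g -> g < m -> g < q * S ->
  let i := g %/ S in let s := rank_of g %% S in zero_act i s /\ zero_pos i s = g.
Proof.
move=> Hz Hm Hg i s; have Hi : i < q by rewrite ltn_divLR.
have Hgi : g = i * S + g %% S := divn_eq g S.
have Hk := ltn_pmod g S_gt0; have Hfk : f i <= g %% S by rewrite leqNgt.
have Hrk : rank_of g = i * S - psum f i + (g %% S - f i).
  rewrite /rank_of (negbTE Hz); have := cntC is_one g.
  rewrite {1}Hgi cnt_seg //; last exact: ltnW.
  by have := psum_seg (ltnW Hi); rewrite (minn_idPr Hfk); lia.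
have Hoff : zero_off i s = g %% S - f i.
  by apply/esym/modn_solve_uniq; [lia | rewrite -Hrk].
have Hpos : zero_pos i s = g by rewrite /zero_pos Hoff; lia.
by split=> //; rewrite /zero_act Hpos Hm andbT; lia.
Qed.

Lemma one_actP i s : i < q -> s < S -> one_act i s ->
  let o := one_pos i s in
  [/\ is_one o, m <= o, o %/ S = i, rank_of o = m - psum f i.+1 + one_off i s & rank_of o %% S = s].
Proof.
move=> Hi Hs /andP[Ho1 Ho2] /=.
have Hf := f_le Hi.
have Hpos : one_pos i s = i * S + (f i - one_off i s).-1 by rewrite /one_pos; lia.
have Hk : (f i - one_off i s).-1 < S by lia.
have Hone : is_one (one_pos i s) by rewrite Hpos one_seg //; lia.
have Hrk : rank_of (one_pos i s) = m - psum f i.+1 + one_off i s.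
  rewrite /rank_of Hone Hpos cnt_seg //; last exact: ltnW.
  by have := psum_mono Hi; rewrite -/m psumS; lia.
split=> //; first by rewrite Hpos divnMDl // divn_small // addn0.
by rewrite Hrk modn_solve.
Qed.

Lemma one_act_ex g : is_one g -> m <= g -> g < q * S ->
  let i := g %/ S in let s := rank_of g %% S in one_act i s /\ one_pos i s = g.
Proof.
move=> H1 Hm Hg i s; have Hi : i < q by rewrite ltn_divLR.
have Hgi : g = i * S + g %% S := divn_eq g S.
have Hk := ltn_pmod g S_gt0; have Hfk : g %% S < f i by [].
have Hf := f_le Hi.
have Hrk : rank_of g = m - psum f i.+1 + (f i - (g %% S).+1).
  rewrite /rank_of H1 {1}Hgi cnt_seg //; last exact: ltnW.
  by have := psum_mono Hi; rewrite -/m psumS; lia.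
have Hoff : one_off i s = f i - (g %% S).+1.
  by apply/esym/modn_solve_uniq; [lia | rewrite -Hrk].
have Hpos : one_pos i s = g by rewrite /one_pos Hoff; lia.
by split=> //; rewrite /one_act Hpos Hoff Hm andbT; lia.
Qed.
End Matching.

(** * Correctness and exclusiveness of the exchange rounds *)

Section Rounds.
Variable E : setting.
Let B := 2 ^ wbits E.
Let n := len E.
Let lab := label E.
Hypothesis B_big : 100 * (n * n) + 100 < B.
Variables q S : nat.
Hypotheses (q_gt0 : 0 < q) (q_le_n : q <= n) (n_le_qS : n <= q * S) (qS_le : q * S <= 2 * n).
Variable M0 : nat -> nat.
Hypothesis M0_lt : forall a, a < n -> M0 a < B.
Variables f M1 : nat -> nat.
Hypothesis M1_packed : packed E q S f M1.

Let m := psum f q.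
Let S0 : 0 < S := S_gt0 q_gt0 q_le_n n_le_qS.
Notation one := (is_one S f).
Notation rank := (rank_of q S f).
Notation zpos := (zero_pos S f).
Notation opos := (one_pos q S f).
Notation zact := (zero_act q S f).
Notation oact := (one_act q S f).
Notation oact_ex := one_act_ex.
Notation zact_ex := zero_act_ex.
Notation oactP := one_actP.
Notation zactP := zero_actP.
Notation zoff := (zero_off S f).
Notation ooff := (one_off q S f).

Lemma f_le i : i < q -> f i <= S.
Proof. by case/M1_packed. Qed.

Lemma one_lt g : g < q * S -> one g -> g < n.
Proof.
move=> Hg H1; have Hi : g %/ S < q by rewrite ltn_divLR.
have [_ Hf _] := M1_packed Hi; move: H1 (divn_eq g S); rewrite /is_one.
by rewrite -/n in Hf; case: Hf => [-> //|]; lia.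
Qed.

(** Ones occur only inside the array, so counting them up to [q * S] or up to [n] gives the same
    number. *)
Lemma m_le_n : m <= n.
Proof.
rewrite /m -(cnt_all S0 f_le) /cnt (big_cat_nat (n := n)) //= -/(cnt one n).
rewrite [X in _ + X]big_nat big1 => [|g /andP[Hn Hg]]; last first.
  by case: (boolP (one g)) => // /(one_lt Hg); lia.
by rewrite addn0; have := cntC one n; lia.
Qed.

Lemma one_lab g : g < n -> lab (M1 g) = one g.
Proof.
move=> Hg; have Hi : g %/ S < q by rewrite ltn_divLR // (leq_trans Hg).
have Hgi := divn_eq g S; have Hk := ltn_pmod g S0.
have [_ _ Hlab] := M1_packed Hi; rewrite /lab Hlab; [|lia|by []].
by rewrite /is_one {1}Hgi ltn_add2l.
Qed.

(** Round [s] handles the ranks congruent to [s], so before it the misplaced elements of residue at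
    least [s] still await their exchange. *)
Definition pending s g := misplaced q S f g && (s <= rank g %% S).

Definition round_inv t0 w0 b s (st : state) :=
  [/\ alive st = q, shuffle n M0 (cells st), env E q S (regs st),
      spent q t0 w0 (b + 150 * s) st &
      (forall i, i < q -> let r := regs st i in
        [/\ r ra = i * S + f i, r rf = f i & r rm = m] /\
        [/\ r rrho = i * S - psum f i, r rsg = m - psum f i.+1 & r rs = s])
      /\ forall g, g < n -> lab (cells st g) = if pending s g then one g else g < m].

Ltac finish := match goal with
  | Hn : is_true (n <= n * n), Hm : is_true (m <= n), HS : is_true (S <= 2 * n),
    H : is_true (?e < S) /\ _ |- _ =>
    revert H; generalize e; clear - Hn Hm HS; intros; lia
  end.

Ltac finish_mod := match goal with
  | Hn : is_true (n <= n * n), Hm : is_true (m <= n), HS : is_true (S <= 2 * n),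
    Hs : is_true (_ < S), H1 : is_true (?x %% S <= S), H2 : is_true (?e < S) /\ _ |- _ =>
    revert H2; generalize e; revert H1; generalize (x %% S); clear - Hn Hm HS Hs; intros; lia
  end.

Lemma round_step_spec t0 w0 b s st : s < S -> round_inv t0 w0 b s st ->
  uniform true rs rS st /\
  wp E round (fun s' => round_inv t0 w0 b s.+1 (spend 1 s')) (spend 1 st).
Proof.
case: st => q' r M t w Hs [/= -> Hsh Henv [d Hd [/= Ht Hw]] [Hr Hlab]].
have HM := shuffle_bounded Hsh M0_lt.
have Hn : n <= n * n by rewrite leq_pmulr // (leq_trans q_gt0).
have Hm := m_le_n.
have HS : S <= 2 * n by apply: leq_trans qS_le; rewrite leq_pmull.
have HSn : S * n <= 2 * (n * n) by rewrite mulnA leq_mul.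
split.
  by move=> i Hi /=; have [_ [_ _ ->]] := Hr i Hi; have [[_ _ _ ->] _] := Henv i Hi.
have Hme i : i < q -> r i rme = i by move=> /Henv[[]].
have HrS i : i < q -> r i rS = S by move=> /Henv[[]].
have Hhi i : i < q -> r i rhi = i * S + S by move=> /Henv[_ []].
have Hz i : i < q -> r i rzero = 0 by move=> /Henv[_ []].
have Ha i : i < q -> r i ra = i * S + f i by move=> /Hr[[]].
have Hf i : i < q -> r i rf = f i by move=> /Hr[[]].
have Hrm i : i < q -> r i rm = m by move=> /Hr[[]].
have Hrho i : i < q -> r i rrho = i * S - psum f i by move=> /Hr[_ []].
have Hsg i : i < q -> r i rsg = m - psum f i.+1 by move=> /Hr[_ []].
have Hrs i : i < q -> r i rs = s by move=> /Hr[_ []].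
have Hseg i (Hi : i < q) : i * S + S <= 2 * n := seg_le qS_le Hi.
have Hzo i : zoff i s < S by apply: ltn_pmod.
have Hoo i : ooff i s < S by apply: ltn_pmod.
have Hdiv a : a %/ S <= a := leq_div a S.
have Hmod a : a %% S <= S by apply/ltnW/ltn_pmod.
apply: wp_seq; apply: wp_load => [i Hi /=|i j Hi Hj _ _ /=|].
- by rewrite Hme //; have Hin := leq_trans Hi q_le_n; split=> //; apply: HM.
- by rewrite !Hme.
have zbound i (Hi : i < q) := conj (Hzo i) (conj (Hseg i Hi) (f_le Hi)).
have obound i (Hi : i < q) := conj (Hoo i) (conj (Hseg i Hi) (f_le Hi)).
apply: wp_seq; apply: wp_set => [i Hi|].
  have H1 := Hmod (i * S - psum f i); have H2 := zbound i Hi; rewrite /zero_off in H2.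
  fits_tac; rewrite ?HrS ?Hrho ?Hrs //; finish_mod.
apply: wp_seq; apply: wp_set => [i Hi|].
  have := zbound i Hi; rewrite /zero_off; fits_tac; rewrite ?HrS ?Hrho ?Hrs ?Ha //;
    finish.
apply: wp_seq; apply: wp_set => [i Hi|].
  have Hprod u v : i * S + S - u <= S -> (i * S + S - u) * (m - v) <= 2 * (n * n).
    move=> H; apply: leq_trans HSn; apply: leq_mul => //.
    exact: leq_trans (leq_subr _ _) Hm.
  have := zbound i Hi; rewrite /zero_off; fits_tac;
    rewrite ?HrS ?Hrho ?Hrs ?Ha ?Hhi ?Hrm //; try (finish);
    apply: leq_trans (Hprod _ _ _) _; finish.
apply: wp_seq; apply: wp_set => [i Hi|].
  have := zbound i Hi; rewrite /zero_off; fits_tac;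
    rewrite ?HrS ?Hrho ?Hrs ?Ha //; try (finish);
    apply: leq_trans (Hdiv _) _; finish.
apply: wp_seq; apply: wp_if; rewrite /=.
set mz := fun i => r i rzero < _.
have Hmz i : i < q -> mz i = zact i s.
  move=> Hi; rewrite /mz Hz // Hhi // Ha // Hrs // HrS // Hrho // Hrm //.
  by rewrite muln_gt0 !subn_gt0.
have Hz_addr i : i < q -> (r i rrho + (r i rs + (r i rS - r i rrho %% r i rS)) %% r i rS) %/ r i rS
    = (i * S - psum f i + zoff i s) %/ S.
  by move=> Hi; rewrite Hrs // HrS // Hrho.
have Hz_val i : i < q -> r i ra + (r i rs + (r i rS - r i rrho %% r i rS)) %% r i rS = zpos i s.
  by move=> Hi; rewrite Hrs // HrS // Hrho // Ha.
(* The rank of a zero is at most its position, which is below [m <= q * S]; so its mailbox is one of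
   the [q] scratch cells. *)
have rank_lt i : i < q -> zact i s -> rank (zpos i s) %/ S < q.
  move=> Hi /(zactP S0 f_le Hi Hs)[H1 H2 _ _ _].
  rewrite ltn_divLR // (leq_ltn_trans (rank_zero_lt q H1)) //.
  by rewrite (leq_trans H2) // (leq_trans Hm).
(* All ranks of this round have residue [s], so equal quotients mean equal ranks: no two processors
   share a mailbox. *)
have z_inj i j : i < q -> j < q -> zact i s -> zact j s ->
    rank (zpos i s) %/ S = rank (zpos j s) %/ S -> i = j.
  move=> Hi Hj /(zactP S0 f_le Hi Hs)[H1 _ H2 _ H3] /(zactP S0 f_le Hj Hs)[H4 _ H5 _ H6] Heq.
  suff Hp : zpos i s = zpos j s by rewrite -H2 Hp H5.
  apply: (@rank_inj_zero q _ _ _ _ H1 H4).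
  by rewrite (divn_eq (rank (zpos i s)) S) (divn_eq (rank (zpos j s)) S) Heq H3 H6.
have Haddr_inj : inj_on q mz (fun i => (r i rrho + (r i rs + (r i rS - r i rrho %% r i rS)) %% r i rS) %/ r i rS).
  move=> i j Hi Hj; rewrite !Hmz // => Hmi Hmj; rewrite !Hz_addr // => Heq.
  have [_ _ _ H1 _] := zactP S0 f_le Hi Hs Hmi; have [_ _ _ H2 _] := zactP S0 f_le Hj Hs Hmj.
  by apply: z_inj => //; rewrite H1 H2.
apply: wpb_store => [i Hi|//|].
  rewrite Hmz //= => Hmi; rewrite Hz_addr // -/n (leq_trans _ q_le_n) //.
  by have [_ _ _ <- _] := zactP S0 f_le Hi Hs Hmi; apply: rank_lt.
apply: wpb_nil => /=; set M2 := store _ _ _ _ _.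
have HM2 i : i < q -> zact i s -> M2 (rank (zpos i s) %/ S) = zpos i s.
  move=> Hi Hmi; have [_ _ _ -> _] := zactP S0 f_le Hi Hs Hmi.
  by rewrite -Hz_addr // /M2 (store_hit _ _ Hi _ Haddr_inj) ?Hmz // Hz_val.
have HM2_out a : q <= a -> M2 a = M a.
  move=> Ha'; rewrite /M2 store_miss // => i Hi; rewrite Hmz // => Hmi Heq.
  have := rank_lt i Hi Hmi; have [_ _ _ -> _] := zactP S0 f_le Hi Hs Hmi.
  by rewrite -Hz_addr // Heq; lia.
apply: wp_seq; apply: wp_set => [i Hi|].
  have H1 := Hmod (m - psum f i.+1); have H2 := obound i Hi; rewrite /one_off in H2.
  fits_tac; rewrite ?HrS ?Hsg ?Hrs //; finish_mod.
apply: wp_seq; apply: wp_set => [i Hi|].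
  have := obound i Hi; rewrite /one_off; fits_tac;
    rewrite ?HrS ?Hsg ?Hrs ?Ha //; finish.
apply: wp_seq; apply: wp_set => [i Hi|].
  have Hprod u v : (f i - u) * (i * S + f i - v - m) <= 4 * (n * n).
    apply: (@leq_trans (S * (2 * n))); last by lia.
    have [_ [H1 H2]] := obound i Hi.
    by apply: leq_mul; clear - H1 H2; lia.
  have := obound i Hi; rewrite /one_off; fits_tac;
    rewrite ?HrS ?Hsg ?Hrs ?Ha ?Hf ?Hrm //; try (finish);
    apply: leq_trans (Hprod _ _) _; finish.
apply: wp_seq; apply: wp_set => [i Hi|].
  have := obound i Hi; rewrite /one_off; fits_tac;
    rewrite ?HrS ?Hsg ?Hrs ?Ha //; finish.
apply: wp_seq; apply: wp_set => [i Hi|].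
  have := obound i Hi; rewrite /one_off; fits_tac;
    rewrite ?HrS ?Hsg ?Hrs ?Ha //; try (finish);
    apply: leq_trans (Hdiv _) _; finish.
apply: wp_seq; apply: wp_if; rewrite /=.
set mo := fun i => r i rzero < _.
have Hmo i : i < q -> mo i = oact i s.
  move=> Hi; rewrite /mo Hz // Ha // Hrs // HrS // Hsg // Hrm // Hf //.
  rewrite muln_gt0 !subn_gt0 /one_act /one_pos -/m -/(ooff i s).
  by apply: andb_id2l => He; clear - He; lia.
have Ho_addr i : i < q -> (r i rsg + (r i rs + (r i rS - r i rsg %% r i rS)) %% r i rS) %/ r i rS
    = (m - psum f i.+1 + ooff i s) %/ S.
  by move=> Hi; rewrite Hrs // HrS // Hsg.
have Ho_val i : i < q -> r i ra - (r i rs + (r i rS - r i rsg %% r i rS)) %% r i rS - 1 = opos i s.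
  by move=> Hi; rewrite Hrs // HrS // Hsg // Ha // subn1.
(* The partner zero has the same rank, hence the same residue, so its owner deposits its address in
   this very round. *)
have oP i : i < q -> oact i s -> exists j, [/\ j < q, zact j s & rank (zpos j s) = rank (opos i s)] /\
    opos i s < n.
  move=> Hi Hmi; have [H1 H2 H3 _ H5] := oactP S0 f_le Hi Hs Hmi.
  have Hoq : opos i s < q * S by rewrite -ltn_divLR // H3.
  have [g [Hg1 Hg2 Hg3]] := match_one S0 f_le H1 H2 Hoq.
  have Hgn := leq_trans Hg1 Hm; have Hgq := leq_trans Hgn n_le_qS.
  have := zact_ex S0 f_le Hg2 Hg1 Hgq; rewrite Hg3 H5 => -[Hza Hzp].
  exists (g %/ S); rewrite Hzp ltn_divLR //; split=> //.
  exact: one_lt.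
have {}oP i : i < q -> oact i s -> [/\ one (opos i s), m <= opos i s, opos i s < n,
    rank (opos i s) %% S = s & opos i s %/ S = i] /\
    exists j, [/\ j < q, zact j s & rank (zpos j s) = rank (opos i s)].
  move=> Hi Hmi; have [H1 H2 H3 _ H5] := oactP S0 f_le Hi Hs Hmi.
  by have [j [? ?]] := oP i Hi Hmi; split=> //; exists j.
have Ho_read i : i < q -> oact i s ->
    let h := M2 ((m - psum f i.+1 + ooff i s) %/ S) in
    [/\ h < m, ~~ one h & rank h = rank (opos i s)].
  move=> Hi Hmi; have [_ _ _ <- _] := oactP S0 f_le Hi Hs Hmi.
  have [_ [j [Hj Hza Hrk]]] := oP i Hi Hmi; rewrite -Hrk HM2 //=.
  by have [H1 H2 _ _ _] := zactP S0 f_le Hj Hs Hza.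
have o_inj i j : i < q -> j < q -> oact i s -> oact j s ->
    rank (opos i s) = rank (opos j s) -> i = j.
  move=> Hi Hj /(oP i Hi)[[H1 _ H2 _ H3] _] /(oP j Hj)[[H4 _ H5 _ H6] _] Heq.
  suff Hp : opos i s = opos j s by rewrite -H3 Hp H6.
  by apply: (rank_inj_one S0 f_le H1 H4 _ _ Heq); apply: leq_trans n_le_qS.
apply: wpb_load => [i Hi|i j Hi Hj|].
- rewrite Hmo //= => Hmi; rewrite Ho_addr //; split; last first.
    by have [H _ _] := Ho_read i Hi Hmi; apply: (word_le B_big); rewrite -/n; lia.
  have [_ _ _ <- _] := oactP S0 f_le Hi Hs Hmi.
  have [_ [j [Hj Hza <-]]] := oP i Hi Hmi.
  by apply: leq_trans q_le_n; apply: rank_lt.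
- rewrite !Hmo //= => Hmi Hmj; rewrite !Ho_addr //.
  have [_ _ _ <- H1] := oactP S0 f_le Hi Hs Hmi.
  have [_ _ _ <- H2] := oactP S0 f_le Hj Hs Hmj => Heq.
  apply: o_inj => //.
  by rewrite (divn_eq (rank (opos i s)) S) (divn_eq (rank (opos j s)) S) Heq H1 H2.
apply: wpb_nil => /=.
apply: wp_seq; apply: wp_store => [i Hi /=|i j Hi Hj _ _ /=|].
- by rewrite Hme // (leq_trans Hi).
- by rewrite !Hme.
rewrite /=; set M3 := store _ _ _ _ _.
(* Only the first [q] cells were overwritten, and each processor has put back the element saved in
   [rst]. *)
have HM3 a : M3 a = M a.
  case: (ltnP a q) => Ha'; last first.
    by rewrite /M3 store_miss ?HM2_out // => i Hi _; rewrite Hme //; lia.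
  rewrite -{1}(Hme a Ha') /M3 (store_hit (m := xpredT)) // ?Hme //.
  by move=> i j Hi Hj _ _; rewrite !Hme.
apply: wp_seq; apply: wp_if; rewrite /= -/mo.
set hp := fun i => M2 ((m - psum f i.+1 + ooff i s) %/ S).
have o_lt i : i < q -> mo i -> opos i s < n.
  by move=> Hi; rewrite Hmo // => /(oP i Hi)[[]].
have h_lt i : i < q -> mo i -> hp i < n.
  by move=> Hi; rewrite Hmo // => /(Ho_read i Hi)[H _ _]; apply: leq_trans Hm.
have op_inj : inj_on q mo (fun i => opos i s).
  by move=> i j Hi Hj; rewrite !Hmo // => Hmi Hmj Heq; apply: o_inj; rewrite ?Heq.
have h_inj : inj_on q mo hp.
  move=> i j Hi Hj; rewrite !Hmo // => Hmi Hmj Heq; apply: o_inj => //.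
  by have [_ _ <-] := Ho_read i Hi Hmi; have [_ _ <-] := Ho_read j Hj Hmj; rewrite -/(hp i) Heq.
(* Vacuously: misplaced ones lie at [m] or beyond, their partners below [m]. *)
have oh i j : i < q -> j < q -> mo i -> mo j -> opos i s = hp j -> i = j.
  move=> Hi Hj; rewrite !Hmo // => /(oP i Hi)[[_ H _ _ _] _] /(Ho_read j Hj)[H' _ _] Heq.
  by move: H; rewrite Heq leqNgt H'.
apply: wpb_load => [i Hi|i j Hi Hj|].
- by move=> Hmi /=; rewrite Ho_val // HM3; have H := o_lt i Hi Hmi; split=> //; apply: HM.
- by move=> Hmi Hmj /=; rewrite !Ho_val //; apply: op_inj.
have Hhp i : i < q -> mo i ->
    (if mo i then M2 ((r i rsg + (r i rs + (r i rS - r i rsg %% r i rS)) %% r i rS) %/ r i rS)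
     else r i rh) = hp i.
  by move=> Hi ->; rewrite Ho_addr.
apply: wpb_load => [i Hi|i j Hi Hj|].
- by move=> Hmi /=; rewrite Hhp // HM3; have H := h_lt i Hi Hmi; split=> //; apply: HM.
- by move=> Hmi Hmj /=; rewrite !Hhp //; apply: h_inj.
apply: wpb_store => [i Hi|i j Hi Hj|].
- by move=> Hmi /=; rewrite Ho_val //; apply: o_lt.
- by move=> Hmi Hmj /=; rewrite !Ho_val //; apply: op_inj.
apply: wpb_store => [i Hi|i j Hi Hj|].
- by move=> Hmi /=; rewrite Hhp //; apply: h_lt.
- by move=> Hmi Hmj /=; rewrite !Hhp //; apply: h_inj.
apply: wpb_nil => /=; set M4 := store _ _ _ _ _.
have HM4 a : M4 a = swap q mo (fun i => opos i s) hp M a.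
  apply: store_ext => [i Hi Hmi|i Hi Hmi|a']; first exact: Hhp.
    by rewrite Hmi HM3 Ho_val.
  by apply: store_ext => // i Hi Hmi; rewrite ?Hmi ?HM3 ?Ho_addr ?Ho_val.
apply: wp_set => [i Hi|].
  by fits_tac; rewrite ?Hrs //; clear - Hs HS Hn; lia.
split=> //=.
- apply: perm_trans Hsh; rewrite (eq_mkseq HM4).
  exact: (swap_shuffle o_lt h_lt op_inj h_inj oh).
- by apply: (spent_add (k := 120) Hd Ht Hw) => /=; clear; lia.
split=> [i Hi|g Hg].
  by rewrite Ha // Hf // Hrm // Hrho // Hsg // Hrs // addn1.
have Hgq : g < q * S := leq_trans Hg n_le_qS.
have done_pending h : rank h %% S = s -> pending s.+1 h = false.
  by rewrite /pending => ->; rewrite ltnn andbF.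
rewrite HM4; case: (swap_cases q mo (fun i => opos i s) hp g) => [[i Hi [Hmi]]|Hno].
  have Hoi : oact i s by rewrite -Hmo.
  have [[H1 H2 H3 H4 _] _] := oP i Hi Hoi; have [H5 H6 H7] := Ho_read i Hi Hoi.
  rewrite -/(hp i) in H5 H6 H7; case=> <-.
    rewrite (swap_x op_inj h_inj oh M Hi Hmi) done_pending // Hlab ?h_lt //.
    by rewrite (negbTE H6) H5 ltnNge H2 /pending /misplaced H5 (negbTE H6) H7 H4 leqnn.
  rewrite (swap_y _ h_inj M Hi Hmi) done_pending ?H7 // Hlab //.
  by rewrite H1 H5 /pending /misplaced H1 ltnNge H2 H4 leqnn.
rewrite swap_other // Hlab //.
(* A misplaced cell of residue [s] would have been exchanged in this round, so an untouched cell
   keeps its status. *)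
suff -> : pending s g = pending s.+1 g by [].
rewrite /pending; case: (boolP (misplaced q S f g)) => //= Hmis.
rewrite [s <= _]leq_eqVlt; case: eqP => //= Hsg'; exfalso.
case: (boolP (one g)) => H1.
  have Hmg : m <= g by move: Hmis; rewrite /misplaced H1 -/m; case: ltnP.
  have Hi : g %/ S < q by rewrite ltn_divLR.
  have := oact_ex S0 f_le H1 Hmg Hgq; rewrite -Hsg' => -[Hoa Hop].
  by have [] := Hno _ Hi (etrans (Hmo _ Hi) Hoa).
have Hmg : g < m by move: Hmis; rewrite /misplaced (negbTE H1) -/m; case: ltnP.
(* A misplaced zero is moved by the owner of the one of equal rank. *)
have [o [/andP[Ho1 Ho2] Ho3 Ho4]] := match_zero S0 f_le H1 Hmg.
have Hi : o %/ S < q by rewrite ltn_divLR.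
have := oact_ex S0 f_le Ho3 Ho1 Ho2; rewrite Ho4 -Hsg' => -[Hoa Hop].
have [_ H5 H6] := Ho_read _ Hi Hoa; have [_] := Hno _ Hi (etrans (Hmo _ Hi) Hoa).
by apply; apply: (@rank_inj_zero q S f); rewrite // H6 Hop.
Qed.

Lemma rounds_spec t0 w0 b st (Q : state -> Prop) : round_inv t0 w0 b 0 st ->
  (forall st', [/\ alive st' = q, shuffle n M0 (cells st'),
      spent q t0 w0 (b + 150 * S + 2) st' &
      forall g, g < n -> lab (cells st' g) = (g < m)] -> Q st') ->
  wp E (While rs rS round) Q st.
Proof.
move=> H0 HQ; apply: (wp_while H0 (N := S)) => [s st'|]; first exact: round_step_spec.
case=> q' r M t w [/= -> Hsh Henv [d Hd [/= Ht Hw]] [Hr Hlab]]; split.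
  move=> i Hi /=; have [_ [_ _ ->]] := Hr i Hi; have [[_ _ _ ->] _] := Henv i Hi.
  by rewrite ltnn.
apply: HQ; split=> //=; first by apply: (spent_add (k := 2) Hd Ht Hw).
by move=> g Hg; rewrite Hlab // /pending leqNgt ltn_pmod // andbF.
Qed.
End Rounds.

(** * Correctness *)

Lemma mkseq_prefix m n :
  mkseq (fun g => g < m) n = nseq (minn m n) true ++ nseq (n - m) false.
Proof.
apply: (@eq_from_nth _ false) => [|i]; rewrite size_mkseq.
  by rewrite size_cat !size_nseq; lia.
move=> Hi; rewrite nth_mkseq // nth_cat size_nseq !nth_nseq.
by do 2?case: ifP; lia.
Qed.

(** Any threshold [m] will do, even one beyond the length: a permutation preserves the label counts,
    which can be read off from [B]. *)
Lemma packing_of_labels (lab : nat -> bool) m (A B : seq nat) : perm_eq B A ->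
  (forall g, g < size B -> lab (nth 0 B g) = (g < m)) -> packing_of lab A B.
Proof.
move=> HBA Hlab; split=> //.
have Hmap : [seq lab x | x <- B] = mkseq (fun g => g < m) (size B).
  apply: (@eq_from_nth _ false) => [|i]; rewrite size_map ?size_mkseq // => Hi.
  by rewrite (nth_map 0) // nth_mkseq // Hlab.
have Hcount a : count (preim lab a) A = count a (mkseq (fun g => g < m) (size B)).
  by rewrite -Hmap count_map; apply/esym/permP.
rewrite (Hcount id) (Hcount negb) Hmap mkseq_prefix !count_cat !count_nseq.
by rewrite mul1n mul0n addn0 add0n mul1n.
Qed.

(** Since [n <= 2 ^ (2 * lg n)], [4 * lg n] bits hold [n * n]; the other [8 * lg n], at least 8,
    give a factor 256, more than the 200 needed. *)
Lemma word_size n w : 0 < n -> 12 * lg n <= w -> 100 * (n * n) + 100 < 2 ^ w.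
Proof.
move=> Hn Hw; apply: (@leq_trans (2 ^ (12 * lg n))); last by rewrite leq_exp2l.
set l := lg n; have Hl : 0 < l by rewrite leq_max.
have Hnl : n <= 2 ^ (2 * l).
  apply: leq_trans (ltnW (trunc_log_ltn n (isT : 1 < 2))) _; rewrite leq_exp2l //.
  have : trunc_log 2 n <= l by rewrite leq_max leqnn orbT.
  by lia.
have Hnn : n * n <= 2 ^ (4 * l).
  by apply: leq_trans (leq_mul Hnl Hnl) _; rewrite -expnD leq_exp2l //; lia.
have -> : 12 * l = 8 * l + 4 * l by lia.
have H8 : 2 ^ 8 <= 2 ^ (8 * l) by rewrite leq_exp2l //; lia.
rewrite expnD; apply: leq_trans (leq_mul H8 Hnn).
have := leq_mul Hn Hn; have -> : 2 ^ 8 = 256 by [].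
by lia.
Qed.

Section Correctness.
Variable E : setting.
Let n := len E.
Let p := par E.
Hypothesis p_gt0 : 0 < p.
Hypothesis p_le_n : p <= n.
Hypothesis B_big : 100 * (n * n) + 100 < 2 ^ wbits E.
Variable M0 : nat -> nat.
Hypothesis M0_lt : forall a, a < n -> M0 a < 2 ^ wbits E.

Definition packing_post (s : state) :=
  [/\ shuffle n M0 (cells s),
      exists m, forall g, g < n -> label E (cells s g) = (g < m),
      wrk s <= 1400 * n & clk s * p <= 3000 * (n * lg p)].

Lemma packing_spec r : wp E packing packing_post (State p r M0 0 0).
Proof.
apply: wp_seq; apply: (prelude_spec p_gt0 p_le_n B_big) => s [y].
set q := cdiv p y; set S := cdiv n q.
case=> -[Hq Hc Ht Hw] [y_gt0 Hy /andP[Hyp Hpy] Henv Hr].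
have q_gt0 : 0 < q by rewrite cdiv_lt // mul0n.
have q_le_p : q <= p by rewrite cdiv_le // leq_pmulr.
have q_le_n := leq_trans q_le_p p_le_n.
have n_le_qS : n <= q * S by rewrite mulnC; apply: cdiv_ge.
have HSq : S * q <= n + q - 1 := cdiv_mul_le n q_gt0.
have qS_le : q * S <= 2 * n by rewrite mulnC; lia.
have Hqy : p <= q * y := cdiv_ge p y_gt0.
have Hqy2 : q * y <= p + y - 1 := cdiv_mul_le p y_gt0.
(* From [q * y <= 2 p <= 2 n <= 2 q S]; this absorbs the time of the prelude into [O(S)]. *)
have Hy2S : y <= 2 * S.
  by rewrite -(leq_pmul2l q_gt0) mulnCA; lia.
have S_gt0 := S_gt0 q_gt0 q_le_n n_le_qS.
have [N HN Hmin] : exists2 N, q <= 2 ^ N & forall e, e < N -> 2 ^ e < q.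
  have Hex : exists N, q <= 2 ^ N by exists q; apply/ltnW/ltn_expl.
  exists (ex_minn Hex); case: ex_minnP => N HN Hmin // e He.
  by rewrite ltnNge; apply/negP => /Hmin; rewrite leqNgt He.
(* As [q <= p < 2 ^ y], at most [y] doublings occur, so the scan takes time [O(S)] as well. *)
have HNy : N <= y.
  rewrite leqNgt; apply/negP => /Hmin; apply/negP; rewrite -leqNgt.
  exact: leq_trans q_le_p (ltnW Hpy).
apply: wp_seq; apply: (local_pack_spec B_big q_gt0 q_le_n n_le_qS qS_le M0_lt
    (t0 := clk s) (w0 := wrk s)).
  split=> //; first by rewrite Hc /shuffle.
    by exists 0; rewrite ?addn0.
  move=> i Hi /=; have [-> ->] := Hr i Hi; rewrite addn0 leqnn; split=> //; first by left.
  by move=> g; rewrite leqNgt; case: ltnP.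
move=> s1 f [Hq1 Hsh1 Henv1 Hsp1 Hpk1] Hr1.
have HM1 := shuffle_bounded Hsh1 M0_lt.
apply: wp_seq; apply: (scan_spec B_big q_gt0 q_le_n n_le_qS qS_le (f_le Hpk1) HM1 HN Hmin Hq1
    erefl Henv1 Hsp1 Hr1) => s2 [Hq2 HM2 Henv2 Hsp2 Hr2].
apply: (rounds_spec B_big q_gt0 q_le_n n_le_qS qS_le M0_lt Hpk1
    (t0 := clk s) (w0 := wrk s) (b := 60 * S + 2 + 60 * N + 100)).
  split=> //; first by rewrite /shuffle (eq_mkseq HM2).
    by rewrite muln0 addn0.
  split=> // g Hg; rewrite HM2.
  rewrite (one_lab B_big q_gt0 q_le_n n_le_qS qS_le Hpk1) // /pending andbT /misplaced.
  by case: ifP => // /negbFE /eqP.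
move=> s3 [Hq3 Hsh3 [d Hd [Ht3 Hw3]] Hlab3]; split=> //; first by exists (psum f q).
  (* With [q * S <= 2 n] this is at most [1000 n]; the prelude contributes the remaining [400 p]. *)
  rewrite Hw3; have : d * q <= 500 * (S * q).
    by rewrite mulnA leq_mul //; lia.
  by lia.
(* The constant 3000 is [750 * 2 * 2], by [S * p <= 2 n y] and [y <= 2 * lg p]. *)
have HT : clk s3 <= 750 * S by rewrite Ht3; lia.
have H1 : S * p <= 2 * (n * y).
  apply: leq_trans (leq_mul (leqnn S) Hqy) _; rewrite mulnA (mulnC S) mulnA.
  exact: leq_mul.
have H2 : n * y <= 2 * (n * lg p) by rewrite mulnCA leq_mul.
by have := leq_mul HT (leqnn p); rewrite -mulnA; lia.
Qed.
End Correctness.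

(** * From the state semantics to machine runs and rational bounds *)

Import GRing.Theory Num.Theory.

Lemma le_ratio (t n p l C : nat) : 0 < p -> t * p <= C * (n * l) ->
  (t%:R <= C%:R * (n%:R / p%:R * l%:R) :> rat)%R.
Proof.
move=> Hp H.
have -> : (C%:R * (n%:R / p%:R * l%:R) = (C * (n * l))%:R / p%:R :> rat)%R.
  by rewrite mulrAC !natrM !mulrA.
by rewrite ler_pdivlMr ?ltr0n // -natrM ler_nat.
Qed.

Theorem theorem16 :
  exists (k c kappa Cw Cs : nat) (prog : program k),
  forall (n p w : nat) (lab : nat -> bool) (A : n.-tuple nat),
    1 <= p <= n ->
    kappa * lg n <= w ->
    all (fun x => x < 2 ^ w) A ->
    let E := Setting w lab n p in
    let P := c * p in
    let bound : rat := (Cs%:R * (n%:R / p%:R * (lg p)%:R))%R in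
    exists T : nat,
      [/\ forall i : 'I_P, halted prog (procs (run E P prog A T) i),
          forall t : nat, t < T ->
            erew prog (run E P prog A t) /\ in_bounds prog (run E P prog A t),
          packing_of lab A (shared (run E P prog A T)),
          pram_work E P prog A T <= Cw * n
        & ((pram_span E P prog A T)%:R <= bound)%R /\ (T%:R <= bound)%R].
Proof.
pose prog := ccode (csize packing) 0 packing.
(* Exactly [p] processors with [nreg] registers each; 12 is the factor from [word_size], and 1400
   and 3000 come from [packing_post]. *)
exists nreg, 1, 12, 1400, 3000, prog => n p w lab A /andP[p_gt0 p_le_n] Hw HA E P bound.
have B_big : 100 * (len E * len E) + 100 < 2 ^ wbits E.
  by apply: word_size => //; apply: leq_trans p_le_n.
have HAn a : a < len E -> nth 0 A a < 2 ^ wbits E.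
  by move=> Ha; apply: (all_nthP 0 HA); rewrite size_tuple.
pose s0 := State p (fun _ _ => 0) (nth 0 A) 0 0.
have Hsize : size prog = csize packing by exact: size_ccode.
have [||||t [cf [s [Hreach _ Hclk Hm [Hsh [m Hlab] Hwrk Hspan]]]]] :=
    @simulated_wp E P prog _ (csize packing) packing (packing_post E (nth 0 A))
      (@start E nreg P A) s0 0 _ packing_wf _ _ (@packing_spec E p_gt0 p_le_n B_big _ HAn _).
- by lia.
- by rewrite Hsize.
- by move=> j.
- split=> //= [|i Hi]; first by rewrite /P mul1n.
  by have := leq_trans (ltn_ord i) (eq_leq (mul1n p)); rewrite ltnNge Hi.
have {Hclk} Hclk : clk s = t by [].
have [Hcf Hsafe Hops] := Hreach; rewrite Hclk in Hspan.
have Hrun j : run E P prog A j = iter j (step prog) (@start E nreg P A) by [].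
case: (Hm) => _ Hlive Hdead Hcells.
exists t; rewrite -/P Hrun -Hcf; split.
- move=> i; case: (ltnP i (alive s)) => Hi; last by case/andP: (Hdead i Hi).
  by have [Hpc _ _] := Hlive i Hi; rewrite /halted Hpc Hsize.
- by move=> j Hj; have [] := Hsafe j Hj.
- apply: (packing_of_labels (m := m)) => [|g]; rewrite ?size_tuple; last first.
    by move=> Hg; rewrite Hcells //; apply: Hlab.
  have Hseq (B : n.-tuple nat) : tval B = mkseq (nth 0 B) n.
    by rewrite -[in LHS](mkseq_nth 0 B) size_tuple.
  rewrite (Hseq A) (Hseq (shared cf)) (_ : mkseq (nth 0 (shared cf)) n = mkseq (cells s) n) //.
  by apply/eq_in_map => a; rewrite mem_iota => /Hcells.
- rewrite /pram_work exchange_big; apply: leq_trans Hwrk.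
  by apply: leq_trans Hops _; rewrite leq_subr.
(* A processor performs at most one operation per step, so the bound on the running time also bounds
   the span. *)
have Hst : pram_span E P prog A t <= t.
  apply/bigmax_leqP => i _; apply: (@leq_trans (\sum_(j < t) 1)).
    by apply: leq_sum => j _; case: isSome.
  by rewrite sum1_card card_ord.
split; apply: le_ratio p_gt0 _; last exact: Hspan.
by apply: leq_trans Hspan; rewrite leq_mul2r Hst orbT.
Qed.
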